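(* Let $n\ge 2$ and let $Z \subset \mathbb{P}^n$ be a set of $n+3$ points in linearly general position. Denote by $\ell_1,\ldots,\ell_{n+3}\in R$ linear forms that are dual to the given points. Let $d$ and $k$ denote positive integers. Then: (i) If $n$ is even and $d>0$, then $\operatorname{reg} R/(\ell_1^d,\ldots,\ell_{n+3}^d) = \frac{(n+2)(d-1)}{2}$. If $n$ is odd, and $n+2$ divides $d-1$ or $d \ge n^2+n+2$, then $\operatorname{reg} R/(\ell_1^d,\ldots,\ell_{n+3}^d) = \left\lfloor \frac{(n+1)(n+3)(d-1)}{2(n+2)} \right\rfloor$. (ii) If $n$ is even and $k>0$, then $\alpha(I_Z^{(k)}) = \left\lceil \frac{(n+2)k}{n} \right\rceil$. If $n$ is odd, and $\frac12(n^2+2n-1)$ divides $k$ or $k \ge \frac{(n^2+n+1)(n^2+2n-1)}{2(n+2)}$, then $\alpha(I_Z^{(k)}) = \left\lceil \frac{(n+1)(n+3)k}{n^2+2n-1} \right\rceil$. (iii) Moreover, if $n$ is odd, then $\alpha(I_Z^{(k)}) \ge \left\lceil \frac{(n+1)(n+3)k}{n^2+2n-1} \right\rceil$ for every $k>0$, and $\operatorname{reg} R/(\ell_1^d,\ldots,\ell_{n+3}^d) \le \left\lfloor \frac{(n+1)(n+3)(d-1)}{2(n+2)} \right\rfloor$ for every $d>0$.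
   Context: $R = K[x_0,\ldots,x_n]$ is the standard graded polynomial ring over an arbitrary field $K$, $\mathbb{P}^n$ is projective space over $K$. A finite set of points in $\mathbb{P}^n$ is in linearly general position if every subset of $r+1 \le n+1$ of its points spans an $r$-dimensional linear subspace. A point $P = (a_0:\ldots:a_n)$ is dual to the linear form $\ell_P = a_0x_0+\cdots+a_nx_n$ (defined up to a nonzero scalar). For an Artinian standard graded algebra $A \ne 0$, $\operatorname{reg} A = \max\{j : [A]_j \ne 0\}$ (Castelnuovo–Mumford regularity). $I_Z\subset R$ is the homogeneous ideal of $Z$ and $I_Z^{(k)} = \bigcap_{P\in Z} I_P^k$ is its $k$-th symbolic power. For a homogeneous ideal $I\ne 0$, $\alpha(I)=\min\{j : [I]_j\ne 0\}$.
   Formalization: The regularity claims in (i) and (iii), false over some fields of small positive characteristic (e.g. n=2, d=2, K=F_4), are proved assuming char K = 0 or char K > r+1, where r is the asserted value or bound; the claims on alpha hold for arbitrary K. *)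

(* Defs.v *)
From HB Require Import structures.
From mathcomp Require Import all_boot all_order all_algebra.
From mathcomp.multinomials Require Export mpoly.

Set Implicit Arguments.
Unset Strict Implicit.
Unset Printing Implicit Defensive.

Import GRing.Theory.
Local Open Scope ring_scope.

(* A point of P^n(K) is a line through the origin of K^(n+1); (a_0 : ... : a_n)
   is the line spanned by the row vector (a_0, ..., a_n). *)
Definition proj_point (K : fieldType) (n : nat) : Type :=
  {U : {vspace 'rV[K]_n.+1} | \dim U == 1%N}.

(* Dimensions here are affine: r + 1 points spanning an r-dimensional linear
   subspace of P^n means that the r + 1 lines span an (r+1)-dimensional
   subspace of K^(n+1). *)
Definition linearly_general_position (K : fieldType) (n m : nat)
    (Z : 'I_m -> proj_point K n) : Prop :=
  forall (r : nat) (A : {set 'I_m}), (r.+1 <= n.+1)%N -> #|A| = r.+1 ->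
    \dim (\sum_(i in A) val (Z i))%VS = r.+1.

Definition dual_form (K : fieldType) (n : nat)
    (P : proj_point K n) (l : {mpoly K[n.+1]}) : Prop :=
  exists a : 'rV[K]_n.+1,
    [/\ a != 0, a \in val P & l = \sum_(i < n.+1) a 0 i *: 'X_i].

Section Ideals.
Variable R : comNzRingType.

Definition ideal_gen (S : R -> Prop) (f : R) : Prop :=
  exists (m : nat) (c g : 'I_m -> R),
    (forall i, S (g i)) /\ f = \sum_(i < m) c i * g i.

Definition ideal_power (I : R -> Prop) (k : nat) : R -> Prop :=
  ideal_gen (fun f => exists g : 'I_k -> R,
    (forall i, I (g i)) /\ f = \prod_(i < k) g i).

End Ideals.

Section Projective.
Variables (K : fieldType) (n : nat).
Local Notation R := {mpoly K[n.+1]}.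

(* Homogeneity is required of the generators and not only implied: over a
   finite field, inhomogeneous polynomials can vanish on a whole line. *)
Definition point_ideal (P : proj_point K n) : R -> Prop :=
  ideal_gen (fun f : R => (exists j, f \is j.-homog) /\
    forall a : 'rV[K]_n.+1, a != 0 -> a \in val P -> f.@[a 0] = 0).

Definition symbolic_power (m : nat) (Z : 'I_m -> proj_point K n) (k : nat)
    (f : R) : Prop :=
  forall i, ideal_power (point_ideal (Z i)) k f.

Definition powers_ideal (m : nat) (l : 'I_m -> R) (d : nat) : R -> Prop :=
  ideal_gen (fun f : R => exists i, f = l i ^+ d).

(* [I]_j <> 0 *)
Definition ideal_degree_nz (I : R -> Prop) (j : nat) : Prop :=
  exists f : R, [/\ f \is j.-homog, I f & f != 0].

(* [R/I]_j = [R]_j / [I]_j <> 0 *)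
Definition quotient_degree_nz (I : R -> Prop) (j : nat) : Prop :=
  exists f : R, f \is j.-homog /\ ~ I f.

(* alpha(I) = a; in particular the homogeneous ideal I is nonzero. *)
Definition is_alpha (I : R -> Prop) (a : nat) : Prop :=
  ideal_degree_nz I a /\ forall j, ideal_degree_nz I j -> (a <= j)%N.

(* reg R/I = r; in particular R/I is nonzero, and it is Artinian since it
   vanishes in all degrees above r. *)
Definition is_reg_quotient (I : R -> Prop) (r : nat) : Prop :=
  quotient_degree_nz I r /\ forall j, quotient_degree_nz I j -> (j <= r)%N.

End Projective.

(* char K = 0 or char K > b.  The duality between [R/(l_1^d, ..., l_m^d)]_j and
   [I_Z^(j-d+1)]_j by differentiation is valid in degrees j < char K, and the
   regularity is not independent of the characteristic: in characteristic 2
   the squares of all linear forms in x_0, x_1, x_2 lie in (x_0^2, x_1^2, x_2^2),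
   so x_0 x_1 x_2 survives modulo any set of such squares. *)
Definition pchar_zero_or_gt (K : fieldType) (b : nat) : Prop :=
  forall p, p \in [pchar K] -> (b < p)%N.

Definition ceil_divn (a b : nat) : nat := (a + b.-1) %/ b.

(* Main.v *)
(* Choose vectors p_i spanning the points, and let f be a form of degree D.  It
   vanishes to order k at p_i if and only if f(X + T p_i) has degree at most
   D - k in T, and by apolarity the forms for which all these degrees are at
   most d - 1 are dual to [R/(l_1^d, ..., l_(n+3)^d)]_D.  Both invariants are
   thus determined by the pairs (D, e) for which some nonzero form f of degree D
   has deg_T f(X + T p_i) <= e for all i; these are given by 2 D <= (n + 2) e if
   n is even, and by 2 (n + 2) D <= (n + 1)(n + 3) e if n is odd.

   Necessity: a standard Cremona map centred at n + 1 of the points transforms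
   f into a form whose degree and line degrees are linear in those of f, and
   these numbers must be nonnegative.  For n even one map suffices; for n odd
   compose (n + 3)/2 of them, one for the complement of each pair in a partition
   of the points into pairs.

   Sufficiency: multiply the determinantal equations of secant varieties of the
   rational normal curves through the projections of the points from some of
   them (cones of degree r whose vertices lie at n + 2 - 2r of the points). *)
Require Import Defs.
From HB Require Import structures.
From mathcomp Require Import all_boot all_order all_algebra.
From mathcomp.multinomials Require Import ssrcomplements mpoly.
From mathcomp Require Import ring zify.

Set Implicit Arguments.
Unset Strict Implicit.
Unset Printing Implicit Defensive.

Import GRing.Theory.
Local Open Scope ring_scope.

(** * Degree along lines *)

Section Evaluation.
Variables (K : comNzRingType) (N : nat).
Implicit Types (f g : {mpoly K[N]}).

Lemma mpoly_alg_ind (P : {mpoly K[N]} -> Prop) :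
  (forall c, P c%:MP) -> (forall i, P 'X_i) ->
  (forall f g, P f -> P g -> P (f + g)) ->
  (forall f g, P f -> P g -> P (f * g)) -> forall f, P f.
Proof.
move=> PC PX PD PM; elim/mpolyind=> [|c m f _ _ Pf].
  by rewrite -(mpolyC0 N); apply: (PC).
apply: (PD) => //; rewrite -mul_mpolyC; apply: (PM) => //; rewrite mpolyXE_id.
elim/big_ind: _ => [|x y|i _]; [exact: PC | exact: PM |].
elim: (m i) => [|k IH]; first by rewrite expr0; apply: (PC).
by rewrite exprS; apply: (PM).
Qed.

Lemma mpoly_rmorph_eq (A : nzRingType) (F G : {rmorphism {mpoly K[N]} -> A}) :
  (forall c, F c%:MP = G c%:MP) -> (forall i, F 'X_i = G 'X_i) -> F =1 G.
Proof.
move=> eqC eqX; apply: mpoly_alg_ind => // f g Ef Eg.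
  by rewrite !rmorphD Ef Eg.
by rewrite !rmorphM Ef Eg.
Qed.

(** One induction serves several later bounds: [F] is taken to be homogeneity, bihomogeneity in X
    and T, a bound on the degree in T, and membership in powers of an ideal. *)
Lemma mmap_filtration (A : comNzRingType) (phi : {rmorphism K -> A})
    (F : nat -> A -> Prop) (c D : nat) (u : 'I_N -> A) f :
  (forall d, F d 0) -> (forall d x y, F d x -> F d y -> F d (x + y)) ->
  (forall a, F 0 (phi a)) ->
  (forall d e x y, F d x -> F e y -> F (d + e)%N (x * y)) ->
  (forall i, F c (u i)) -> f \is D.-homog -> F (c * D)%N (mmap phi u f).
Proof.
move=> F0 FD FC FM Fu /dhomogP hf; rewrite /mmap big_seq.
apply: big_ind => //; first exact: FD.
move=> m /hf <-; rewrite -[(c * _)%N]add0n; apply: (FM) => //.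
rewrite /= mdegE big_distrr /= /mmap1.
apply: (big_ind2 (fun (d : nat) x => F d x)).
- by rewrite -(rmorph1 phi); apply: (FC).
- by move=> ? ? ? ?; apply: (FM).
move=> i _; elim: (m i) => [|k IH].
  by rewrite muln0 expr0 -(rmorph1 phi); apply: (FC).
by rewrite mulnS exprS; apply: (FM).
Qed.

Lemma eq_mmap (A : nzRingType) (phi : K -> A) (u v : 'I_N -> A) f :
  u =1 v -> mmap phi u f = mmap phi v f.
Proof. by move=> uv; apply: eq_bigr => m _; rewrite (mmap1_eq _ uv). Qed.

Lemma rmorph_mmap (A : comNzRingType) (phi : {rmorphism K -> A})
    (B : comNzRingType) (psi : {rmorphism K -> B})
    (F : {rmorphism A -> B}) (u : 'I_N -> A) f :
  (forall c, F (phi c) = psi c) ->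
  F (mmap phi u f) = mmap psi (fun i => F (u i)) f.
Proof.
move=> E; apply: (mpoly_rmorph_eq (F := F \o mmap phi u) (G := mmap psi (fun i => F (u i)))).
  by move=> c /=; rewrite !mmapC E.
by move=> i /=; rewrite !mmapX !mmap1U.
Qed.

Lemma mmap_id f : mmap (@mpolyC N K) (fun i => 'X_i) f = f.
Proof.
rewrite {2}[f]mpolyE; apply: eq_bigr => m _.
by rewrite -mul_mpolyC mmap1_id.
Qed.

End Evaluation.

Section Translate.
Variables (K : fieldType) (N : nat).
Implicit Types (f g : {mpoly K[N]}) (p : 'rV[K]_N).

(* f(X + T p), a polynomial in T over K[X] *)
Definition translate p : {mpoly K[N]} -> {poly {mpoly K[N]}} :=
  mmap (polyC \o @mpolyC N K) (fun i => ('X_i)%:P + (p 0 i)%:MP *: 'X).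

HB.instance Definition _ p := GRing.RMorphism.on (translate p).

Lemma translateC p c : translate p c%:MP = c%:MP%:P.
Proof. by rewrite /translate mmapC. Qed.

Lemma translateXU p i : translate p 'X_i = ('X_i)%:P + (p 0 i)%:MP *: 'X.
Proof. by rewrite /translate mmapX mmap1U. Qed.

Lemma horner_translate (A : comNzRingType) (phi : {rmorphism K -> A}) p
    (y : 'I_N -> A) (t : A) f :
  (map_poly (mmap phi y) (translate p f)).[t] =
  mmap phi (fun i => y i + t * phi (p 0 i)) f.
Proof.
apply: (mpoly_rmorph_eq
  (F := horner_eval t \o map_poly (mmap phi y) \o translate p)
  (G := mmap phi (fun i => y i + t * phi (p 0 i)))).
  by move=> c /=; rewrite translateC /= map_polyC /= !mmapC /horner_eval hornerC.
move=> i /=; rewrite translateXU rmorphD /= map_polyC linearZ /= map_polyX.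
by rewrite /horner_eval !hornerE !mmapX mmapC !mmap1U mulrC.
Qed.

Lemma translateE p f : translate p f =
  mmap (polyC \o @mpolyC N K) (fun i => ('X_i)%:P + (p 0 i)%:MP *: 'X) f.
Proof. by []. Qed.

End Translate.

Opaque translate.

Section LineDegree.
Variables (K : fieldType) (N : nat).
Implicit Types (f g : {mpoly K[N]}) (p : 'rV[K]_N).

(* For f homogeneous of degree D this says that f vanishes to order at least
   D - e at the projective point p. *)
Definition ldeg_le p e f := (size (translate p f) <= e.+1)%N.

Lemma ldeg_leM p d e f g :
  ldeg_le p d f -> ldeg_le p e g -> ldeg_le p (d + e) (f * g).
Proof.
rewrite /ldeg_le rmorphM /= => hf hg; apply: leq_trans (size_polyMleq _ _) _.
by rewrite -subn1 leq_subLR add1n -addnS -addSn; apply: leq_add.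
Qed.

Lemma ldeg_leW p d e f : (d <= e)%N -> ldeg_le p d f -> ldeg_le p e f.
Proof. by rewrite /ldeg_le => de hf; apply: leq_trans hf _. Qed.

Lemma ldeg_le1 p e : ldeg_le p e 1.
Proof. by rewrite /ldeg_le rmorph1 size_poly1. Qed.

(** For i > D the degree [D - i] is truncated to 0, hence the separate vanishing clause. *)
Definition bihomog D (q : {poly {mpoly K[N]}}) :=
  forall i, q`_i \is (D - i).-homog /\ ((D < i)%N -> q`_i = 0).

Lemma bihomogM D E q r : bihomog D q -> bihomog E r -> bihomog (D + E) (q * r).
Proof.
move=> hq hr i; rewrite coefM.
have h (j : 'I_i.+1) : q`_j * r`_(i - j) \is (D + E - i).-homog /\
    ((D + E < i)%N -> q`_j * r`_(i - j) = 0).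
  have [hq1 hq2] := hq j; have [hr1 hr2] := hr (i - j)%N.
  have lji := ltn_ord j.
  case: (ltnP D j) => [/hq2 ->|Dj]; first by rewrite mul0r; split=> //; exact: dhomog0.
  case: (ltnP E (i - j)) => [/hr2 ->|Eij]; first by rewrite mulr0; split=> //; exact: dhomog0.
  split; last by lia.
  have -> : (D + E - i = (D - j) + (E - (i - j)))%N by lia.
  exact: dhomogM.
split; first by apply: rpred_sum => j _; case: (h j).
by move=> lt; apply: big1 => j _; case: (h j) => _; apply.
Qed.

Lemma bihomog_translate p D f : f \is D.-homog -> bihomog D (translate p f).
Proof.
rewrite -{2}[D]mul1n translateE; apply: mmap_filtration.
- by move=> d i; rewrite coef0; split=> //; exact: dhomog0.
- move=> d x y hx hy i; rewrite coefD; have [a1 a2] := hx i; have [b1 b2] := hy i.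
  split; first exact: rpredD.
  by move=> lt; rewrite a2 // b2 // addr0.
- move=> c i /=; rewrite coefC; case: eqP => [->|].
    by rewrite -[_%:MP]mulr1 mul_mpolyC; split=> //; apply: dhomogZ; exact: dhomog1.
  by split=> //; exact: dhomog0.
- exact: bihomogM.
move=> i k; rewrite coefD coefC coefZ coefX.
case: k => [|[|k]] /=.
- by rewrite mulr0 addr0 dhomogX /= mdeg1.
- rewrite mulr1 add0r -[_%:MP]mulr1 mul_mpolyC; split=> //; apply: dhomogZ; exact: dhomog1.
- by rewrite mulr0 addr0; split=> //; exact: dhomog0.
Qed.

(** Taylor's formula along p, transported from the generic X and T to arbitrary y and t. *)
Lemma mmap_translate (A : comNzRingType) (phi : {rmorphism K -> A}) p e
    (y : 'I_N -> A) (t : A) f :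
  ldeg_le p e f ->
  mmap phi (fun i => y i + t * phi (p 0 i)) f =
  \sum_(i < e.+1) mmap phi y (translate p f)`_i * t ^+ i.
Proof.
move=> hf; rewrite -horner_translate (@horner_coef_wide _ e.+1).
  by apply: eq_bigr => i _; rewrite coef_map.
exact: leq_trans (size_poly _ _) hf.
Qed.

Lemma size_mmap_translate p e (u : 'I_N -> {mpoly K[N]}) c f :
  ldeg_le p e f ->
  (size (mmap (polyC \o @mpolyC N K)
     (fun i => (u i)%:P + (c%:P * 'X) * (p 0 i)%:MP%:P)%R f) <= e.+1)%N.
Proof.
move=> hf; rewrite (mmap_translate (polyC \o @mpolyC N K) _ _ hf).
apply: leq_trans (size_sum _ _ _) _; apply/bigmax_leqP => i _.
rewrite -(rmorph_mmap (phi := @mpolyC N K) (F := polyC)) //.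
rewrite exprMn -polyC_exp mulrA -polyCM mul_polyC.
apply: leq_trans (size_scale_leq _ _) _.
by rewrite size_polyXn; have := ltn_ord i; lia.
Qed.

Lemma ldeg_le0 p e : ldeg_le p e 0.
Proof. by rewrite /ldeg_le rmorph0 size_poly0. Qed.

Lemma ldeg_leD p e f g : ldeg_le p e f -> ldeg_le p e g -> ldeg_le p e (f + g).
Proof.
rewrite /ldeg_le rmorphD /= => hf hg; apply: leq_trans (size_polyD _ _) _.
rewrite geq_max; apply/andP; split; [exact: hf | exact: hg].
Qed.

Lemma ldeg_le_scale p c e f : ldeg_le p e f -> ldeg_le p e (c *: f).
Proof.
rewrite -mul_mpolyC -[e]add0n; apply: ldeg_leM.
by rewrite /ldeg_le translateC size_polyC leq_b1.
Qed.

Lemma ldeg_le_prod (I : Type) (r : seq I) p (d : I -> nat) (F : I -> {mpoly K[N]}) :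
  (forall i, ldeg_le p (d i) (F i)) ->
  ldeg_le p (\sum_(i <- r) d i) (\prod_(i <- r) F i).
Proof.
move=> hF; apply: (big_ind2 (fun e g => ldeg_le p e g)) => //.
  exact: ldeg_le1.
by move=> ? ? ? ?; apply: ldeg_leM.
Qed.

Lemma ldeg_leX p e f k : ldeg_le p e f -> ldeg_le p (k * e) (f ^+ k).
Proof.
move=> hf; elim: k => [|k IH]; first exact: ldeg_le1.
by rewrite exprS mulSn; apply: ldeg_leM.
Qed.

End LineDegree.

(** * Linear changes of coordinates *)

Section LinearChange.
Variables (K : fieldType) (N : nat).
Implicit Types (f g : {mpoly K[N]}) (p : 'rV[K]_N) (A B : 'M[K]_N).

(* f(xB) *)
Definition linsub B : {mpoly K[N]} -> {mpoly K[N]} :=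
  mmap (@mpolyC N K) (fun i => \sum_j (B j i)%:MP * 'X_j).

HB.instance Definition _ B := GRing.RMorphism.on (linsub B).

Lemma linsubC B c : linsub B c%:MP = c%:MP.
Proof. by rewrite /linsub mmapC. Qed.

Lemma linsubXU B i : linsub B 'X_i = \sum_j (B j i)%:MP * 'X_j.
Proof. by rewrite /linsub mmapX mmap1U. Qed.

Lemma linsub_homog B D f : f \is D.-homog -> linsub B f \is D.-homog.
Proof.
move=> hf; rewrite -[D]mul1n.
apply: (@mmap_filtration _ _ _ _ (fun d (x : {mpoly K[N]}) => x \is d.-homog)) hf.
- by move=> d; exact: dhomog0.
- by move=> d x y; exact: dhomogD.
- by move=> a /=; rewrite -[mpolyC N a]mulr1 mul_mpolyC; apply: dhomogZ; exact: dhomog1.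
- by move=> d e x y; exact: dhomogM.
move=> i; apply: rpred_sum => j _; rewrite mul_mpolyC; apply: dhomogZ.
by rewrite dhomogX /= mdeg1.
Qed.

Lemma linsubM A B f : linsub A (linsub B f) = linsub (A *m B) f.
Proof.
rewrite {2}/linsub (rmorph_mmap (psi := @mpolyC N K)) => [|c]; last first.
  exact: linsubC.
apply: eq_mmap => i; rewrite rmorph_sum /=.
under eq_bigr => j _.
  rewrite rmorphM /= linsubC linsubXU mulr_sumr.
  over.
rewrite exchange_big /=; apply: eq_bigr => j _; rewrite mxE rmorph_sum mulr_suml.
by apply: eq_bigr => k _ /=; rewrite mpolyCM; ring.
Qed.

Lemma linsub1 f : linsub 1%:M f = f.
Proof.
rewrite -[RHS]mmap_id; apply: eq_mmap => i.
rewrite (bigD1 i) //= big1 ?addr0 => [|j ji]; first by rewrite mxE eqxx mul1r.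
by rewrite mxE (negPf ji) mpolyC0 mul0r.
Qed.

Lemma linsub_neq0 B f : B \in unitmx -> f != 0 -> linsub B f != 0.
Proof.
move=> uB; apply: contra_neq => h.
by rewrite -[f]linsub1 -(mulVmx uB) -linsubM h rmorph0.
Qed.

Lemma ldeg_linsub p B e f : ldeg_le (p *m B) e f -> ldeg_le p e (linsub B f).
Proof.
move=> /(size_mmap_translate (fun i => \sum_j (B j i)%:MP * 'X_j) 1).
rewrite /ldeg_le /linsub (rmorph_mmap (psi := polyC \o @mpolyC N K)); last first.
  by move=> c /=; rewrite translateC.
apply: leq_trans; apply: eq_leq; congr (size (_ : {poly _})); apply: eq_mmap => i.
rewrite mxE !rmorph_sum /= mulr_sumr -big_split.
apply: eq_bigr => j _ /=; rewrite rmorphM /= translateC translateXU.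
by rewrite mpolyCM -mul_polyC !polyCM polyC1; ring.
Qed.

End LinearChange.

Section CoordinatePoints.
Variables (K : fieldType) (N : nat).
Implicit Types (f g : {mpoly K[N]}).

(** Translation along a coordinate vector moves only X_i, so the degree in T is the degree in
    X_i. *)
Lemma ldeg_deltaP i e f :
  ldeg_le (delta_mx 0 i) e f <-> (forall m, m \in msupp f -> m i <= e)%N.
Proof.
split=> [hf|hf]; last first.
  rewrite [f]mpolyE big_seq.
  apply: (big_ind (ldeg_le (delta_mx 0 i) e)).
  - exact: ldeg_le0.
  - exact: ldeg_leD.
  move=> m /hf lem; apply: ldeg_le_scale; apply: ldeg_leW lem _.
  rewrite mpolyXE_id.
  have -> : m i = (\sum_(j < N) m j * (j == i))%N.
    rewrite (bigD1 i) //= eqxx muln1 big1 ?addn0 // => j /negPf ->.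
    by rewrite muln0.
  apply: ldeg_le_prod => j; apply: ldeg_leX.
  rewrite /ldeg_le translateXU mxE eqxx /=.
  case: (j == i); last by rewrite mpolyC0 scale0r addr0 size_polyC leq_b1.
  rewrite scale1r; apply: leq_trans (size_polyD _ _) _.
  by rewrite size_polyX geq_max size_polyC; case: (_ == _).
pose P d g := forall m : 'X_{1..N}, m \in msupp g -> (m i <= d)%N.
have P0 d : P d 0 by move=> m; rewrite msupp0.
have PD d x y : P d x -> P d y -> P d (x + y).
  by move=> hx hy m /msuppD_le; rewrite mem_cat => /orP[/hx|/hy].
have PM d e' x y : P d x -> P e' y -> P (d + e')%N (x * y).
  move=> hx hy m /msuppM_le/allpairsP[[m1 m2] /= [/hx h1 /hy h2 ->]].
  by rewrite mnmDE leq_add.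
have PC d c : P d c%:MP.
  by move=> m; rewrite msuppC; case: eqP => // _; rewrite inE => /eqP ->; rewrite mnm0E.
have PX j d : P ((j == i) + d)%N 'X_j.
  by move=> m; rewrite msuppX inE => /eqP ->; rewrite mnm1E leq_addr.
(* [y] deletes X_i from the variables. Taylor's formula for f = f(y + X_i e_i) has coefficients free
   of X_i, multiplied by X_i^k with k at most e. *)
pose y j : {mpoly K[N]} := 'X_j *+ (j != i).
have Py h : P 0%N (mmap (@mpolyC N K) y h).
  elim/mpoly_alg_ind: h => [c|j|g h Pg Ph|g h Pg Ph].
  - by rewrite mmapC; apply: PC.
  - rewrite mmapX mmap1U /y; case: eqP => [_|/eqP ji]; first by rewrite mulr0n.
    by have := PX j 0%N; rewrite (negPf ji).
  - by rewrite mmapD; apply: PD.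
  - by rewrite rmorphM; have := PM _ _ _ _ Pg Ph.
have -> : f = mmap (@mpolyC N K)
    (fun j => y j + 'X_i * ((delta_mx 0 i : 'rV[K]_N) 0 j)%:MP) f.
  rewrite -[LHS]mmap_id; apply: eq_mmap => j; rewrite mxE eqxx /= /y.
  by case: eqP => [->|_]; rewrite /= ?mpolyC0 ?mulr0 ?addr0 // add0r mulr1.
rewrite (mmap_translate (@mpolyC N K) y 'X_i hf).
apply: (big_ind (P e)) => [||k _]; [exact: P0 | exact: PD |].
suff h : P (0 + k)%N (mmap (@mpolyC N K) y (translate (delta_mx 0 i) f)`_k * 'X_i ^+ k).
  by move=> m /h /leq_trans; apply; have := ltn_ord k; lia.
apply: (PM) => //; elim: (nat_of_ord k) => [|j IH]; first exact: PC.
by rewrite exprS -add1n; apply: (PM) => //; have := PX i 0%N; rewrite eqxx.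
Qed.

End CoordinatePoints.

(** * Cremona transformations *)

Section Cremona.
Variables (K : fieldType) (N : nat).
Implicit Types (f : {mpoly K[N]}) (e m : 'X_{1..N}).

(* X^e f(1/X) *)
Definition cremona e f : {mpoly K[N]} :=
  \sum_(m <- msupp f) f@_m *: 'X_[(e - m)%MM].

Variables (e : 'X_{1..N}) (f : {mpoly K[N]}).
Hypothesis le_e : forall m, m \in msupp f -> (m <= e)%MM.

Lemma cremona_neq0 : f != 0 -> cremona e f != 0.
Proof.
rewrite -msupp_eq0; case E : (msupp f) => [|m s] // _.
have mf : m \in msupp f by rewrite E mem_head.
have : (cremona e f)@_(e - m)%MM = f@_m.
  rewrite /cremona raddf_sum (bigD1_seq m) ?msupp_uniq //=.
  rewrite mcoeffZ mcoeffX eqxx mulr1 big_seq_cond big1 ?addr0 // => m' /andP[m'f m'm].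
  rewrite mcoeffZ mcoeffX; case: eqP => [E'|_]; last by rewrite mulr0.
  case/eqP: m'm; apply/mnmP => i; move/mnmP/(_ i): E'; rewrite !mnmBE.
  by have /mnm_lepP/(_ i) := le_e m'f; have /mnm_lepP/(_ i) := le_e mf; lia.
by move=> h; move: mf; rewrite mcoeff_msupp -h; apply: contra_neq => ->; rewrite mcoeff0.
Qed.

Lemma cremona_homog D : f \is D.-homog -> cremona e f \is (mdeg e - D).-homog.
Proof.
move=> /dhomogP hf; rewrite /cremona big_seq; apply: rpred_sum => m mf.
apply: dhomogZ; rewrite dhomogX /=; apply/eqP.
by rewrite -(hf _ mf) /= -{2}(submK (le_e mf)) mdegD addnK.
Qed.

Lemma ldeg_cremona_delta i : ldeg_le (delta_mx 0 i) (e i) (cremona e f).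
Proof.
apply/ldeg_deltaP => m; rewrite mcoeff_msupp; apply: contraNT => lt.
rewrite /cremona raddf_sum big1 // => m' _ /=; rewrite mcoeffZ mcoeffX.
case: eqP => [E|_]; last by rewrite mulr0.
by move: lt; rewrite -E mnmBE leq_subr.
Qed.

(** Replacing 1/u_i by the product of the other u_j clears the denominators in u^e f(1/u) = g(u),
    where g = [cremona e f]; homogeneity of f produces the power of the full product. *)
Lemma mmap_cremona (A : comNzRingType) (phi : {rmorphism K -> A}) (u : 'I_N -> A) D :
  f \is D.-homog ->
  mmap phi (fun i => \prod_(j | j != i) u j) f * \prod_i u i ^+ e i =
  (\prod_i u i) ^+ D * mmap phi u (cremona e f).
Proof.
move=> /dhomogP hf; rewrite /cremona raddf_sum mulr_sumr {1}/mmap mulr_suml.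
rewrite big_seq [RHS]big_seq; apply: eq_bigr => m mf /=.
rewrite mmapZ mmapX /mmap1 mulrCA -mulrA; congr (_ * _).
rewrite -(hf _ mf) /= mdegE expr_sum -!big_split /=; apply: eq_bigr => i _.
have -> : \prod_j u j = u i * \prod_(j | j != i) u j by rewrite (bigD1 i).
have /mnm_lepP/(_ i) mi := le_e mf.
by rewrite mnmBE -{1}(subnKC mi) exprMn exprD; ring.
Qed.

End Cremona.

(** The [c i] may be zero or zero divisors, so the bound concerns the product minus its formal
    leading term. *)
Lemma size_prod_linear_lead (A : comNzRingType) (I : Type) (s : seq I) (x c : I -> A) :
  (size (\prod_(i <- s) ((x i)%:P + c i *: 'X)
     - (\prod_(i <- s) c i) *: 'X^(size s))%R <= size s)%N.
Proof.
elim: s => [|i s IH]; first by rewrite !big_nil expr0 scale1r subrr size_poly0.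
rewrite !big_cons /=; set P := \prod_(j <- s) _; set C := \prod_(j <- s) _.
have -> : (((x i)%:P + c i *: 'X) * P - (c i * C) *: 'X^((size s).+1) =
   x i *: P + (c i *: (P - C *: 'X^(size s))) * 'X)%R.
  by rewrite -!mul_polyC !polyCM exprS; ring.
apply: leq_trans (size_polyD _ _) _; rewrite geq_max; apply/andP; split.
  apply: leq_trans (size_scale_leq _ _) _.
  rewrite -[P](subrK (C *: 'X^(size s))%R).
  apply: leq_trans (size_polyD _ _) _; rewrite geq_max; apply/andP; split.
    exact: leq_trans IH _.
  by apply: leq_trans (size_scale_leq _ _) _; rewrite size_polyXn.
apply: leq_trans (size_polyMleq _ _) _; rewrite size_polyX addn2 /= ltnS.
exact: leq_trans (size_scale_leq _ _) IH.
Qed.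

Lemma translate_eq0 (K : fieldType) (N : nat) (p : 'rV[K]_N) f :
  (translate p f == 0) = (f == 0).
Proof.
apply/eqP/eqP => [h|->]; last by rewrite rmorph0.
have E : (translate p f).[0] = f.
  apply: (mpoly_rmorph_eq (F := horner_eval 0 \o translate p) (G := idfun)).
    by move=> c /=; rewrite translateC /horner_eval hornerC.
  by move=> i /=; rewrite translateXU /horner_eval !hornerE ?mulr0 ?addr0.
by rewrite -E h horner0.
Qed.

Section CremonaTorus.
Variables (K : fieldType) (n : nat).
Implicit Types (f : {mpoly K[n.+1]}).

(** For the transform g this says deg_T g(X + T/a) <= |e| - 2 D + d, arranged to avoid truncated
    subtraction. *)
Lemma ldeg_cremona_torus (a : 'rV[K]_n.+1) (e : 'X_{1..n.+1}) D d f :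
  (0 < n)%N -> (forall i, a 0 i != 0) -> f != 0 -> f \is D.-homog ->
  (forall m, m \in msupp f -> (m <= e)%MM) -> ldeg_le a d f ->
  (size (translate (\row_i (a 0 i)^-1)%R (cremona e f)) + 2 * D <= mdeg e + d.+1)%N.
Proof.
move=> n0 a0 f0 fD le_e hd.
set b := \row_i _; pose x i : {mpoly K[n.+1]} := 'X_i.
pose c i : {mpoly K[n.+1]} := (b 0 i)%:MP.
pose u i := (x i)%:P + c i *: 'X.
pose phi : {rmorphism K -> {poly {mpoly K[n.+1]}}} := polyC \o @mpolyC n.+1 K.
have c0 i : c i != 0 by rewrite /c mpolyC_eq0 mxE invr_eq0.
have su i : size (u i) = 2.
  rewrite /u addrC size_polyDl; rewrite size_scale ?size_polyX //.
  by rewrite size_polyC; case: (_ == _).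
have u0 i : u i != 0 by rewrite -size_poly_gt0 su.
set g := cremona e f.
have g0 : translate b g != 0 by rewrite translate_eq0 cremona_neq0.
have gE : translate b g = mmap phi u g by rewrite translateE.
(* With u = X + T / a, Cremona's identity reduces the claim to a bound for the
   T-degree of f(w), where w_i is a constant times a_i T^n plus lower terms. *)
have := mmap_cremona le_e phi u fD; rewrite -/g -gE.
set w := fun i => _; set W := mmap phi w f => E.
have sW : (size W <= n.-1 * D + d + 1)%N.
  (* [z i] is w_i without its term of degree n in T. Thus f(w) is a Taylor expansion at z along a,
     with parameter a multiple of T^n. *)
  pose z i := w i - (\prod_i c i) *: 'X^n * phi (a 0 i).
  have sz i : (size (z i) <= n.-1.+1)%N.
    rewrite prednK //.
    have := size_prod_linear_lead (enum (predC1 i)) x c.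
    rewrite -cardE cardC1 card_ord !big_enum /= => h.
    rewrite /z /w; apply: leq_trans h; apply: eq_leq; congr (size (_ : {poly _})); congr (_ - _).
    rewrite (bigD1 i) //= -mul_polyC -!mul_polyC mulrC mulrA -!polyCM; congr (_ * _).
    rewrite mulrA -mpolyCM mxE divff // ?mpolyC1 ?mul1r //.
  have -> : W = \sum_(k < d.+1) mmap phi z (translate a f)`_k *
      ((\prod_i c i) *: 'X^n) ^+ k.
    rewrite -(mmap_translate phi _ _ hd); apply: eq_mmap => i.
    by rewrite /z subrK.
  (* The k-th term has degree at most (n - 1)(D - k) + n k = (n - 1) D + k, and k is at most d. *)
  apply: leq_trans (size_sum _ _ _) _; apply/bigmax_leqP => k _.
  have [hk1 hk2] := bihomog_translate a fD k.
  case: (ltnP D k) => [/hk2 ->|kD]; first by rewrite mmap0 mul0r size_poly0.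
  have hz : (size (mmap phi z (translate a f)`_k) <= (n.-1 * (D - k)).+1)%N.
    apply: (mmap_filtration (F := fun (j : nat) (y : {poly {mpoly K[n.+1]}}) =>
      (size y <= j.+1)%N) _ _ _ _ sz hk1).
    - by move=> j; rewrite size_poly0.
    - move=> j y y' hy hy'; apply: leq_trans (size_polyD _ _) _.
      by rewrite geq_max; apply/andP; split; [exact: hy | exact: hy'].
    - by move=> r; rewrite size_polyC leq_b1.
    - move=> j j' y y' hy hy'; apply: leq_trans (size_polyMleq _ _) _.
      by rewrite -subn1 leq_subLR add1n -addnS -addSn; apply: leq_add.
  have ht : (size (((\prod_i c i) *: 'X^n : {poly {mpoly K[n.+1]}}) ^+ k) <= (n * k).+1)%N.
    rewrite exprZn -exprM; apply: leq_trans (size_scale_leq _ _) _.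
    by rewrite size_polyXn.
  apply: leq_trans (size_polyMleq _ _) _; rewrite -subn1 leq_subLR.
  apply: leq_trans (leq_add hz ht) _.
  have := ltn_ord k; rewrite ltnS => kd.
  have : (n = n.-1.+1)%N by case: (n) n0.
  by move: kD kd; clear; move: (nat_of_ord k) (n.-1) => k' n' kD kd ->; nia.
have deg (r : 'I_n.+1 -> nat) :
    (\prod_i u i ^+ r i != 0) /\ size (\prod_i u i ^+ r i)%R = (\sum_i r i).+1.
  split; first by apply/prodf_neq0 => i _; apply: expf_neq0; exact: u0.
  rewrite size_prod => [|i _]; last by rewrite expf_neq0.
  have sk i : size (u i ^+ r i) = (r i + 1)%N.
    by rewrite -[LHS]prednK ?size_poly_gt0 ?expf_neq0 // size_exp su mul1n addn1.
  under eq_bigr => i _ do rewrite sk.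
  by rewrite big_split /= sum_nat_const muln1 -addSn addnK.
have [U1 U2] := deg e; have [V1 V2] := deg (fun=> 1%N).
rewrite sum1_card card_ord in V2; have VE : \prod_i u i ^+ 1 = \prod_i u i by [].
rewrite VE in V1 V2.
have : (size (W * \prod_i u i ^+ e i)%R <= size W + mdeg e)%N.
  apply: leq_trans (size_polyMleq _ _) _.
  by rewrite U2 /= addnS mdegE.
(* Over a domain degrees add up: each u_i has degree exactly 1, so the right-hand side has degree (n
   + 1) D plus that of the translate of g. *)
rewrite E => h; have : (size ((\prod_i u i) ^+ D * translate b g)%R = n.+1 * D + size (translate b g))%N.
  have P0 : (\prod_i u i) ^+ D != 0 by apply: expf_neq0; exact: V1.
  have sP : size ((\prod_i u i) ^+ D)%R = (n.+1 * D).+1.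
    by rewrite -[LHS]prednK ?size_poly_gt0 // size_exp V2.
  by rewrite size_mul // sP.
move=> h'; rewrite h' in h; clear E h' gE.
have : (n = n.-1.+1)%N by case: (n) n0.
move: (size W) (size _) sW h => p q; nia.
Qed.

End CremonaTorus.

(** * Points in linearly general position *)

Section Configurations.
Variables (K : fieldType) (n : nat).
Local Notation point := 'rV[K]_n.+1.

(* Linearly general position, stated dually: a hyperplane contains at most n of
   the points. *)
Definition lgp (p : 'I_(n + 3) -> point) :=
  forall v : 'cV[K]_n.+1, v != 0 -> (#|[set i | (p i *m v == 0)%R]| <= n)%N.

(** The points indexed by [h] will be moved to the coordinate points; those of index a and b then
    lie off the coordinate hyperplanes. *)
Definition frame (a b : 'I_(n + 3)) (h : 'I_n.+1 -> 'I_(n + 3)) :=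
  [/\ a != b, injective h, forall j, (h j != a) && (h j != b) &
      forall i, i != a -> i != b -> exists j, i = h j].

Lemma frame_exists (a b : 'I_(n + 3)) : a != b -> exists h, frame a b h.
Proof.
move=> ab; pose A := ~: [set a; b].
have cA : n.+1 = #|A| by have := cardsC [set a; b]; rewrite cards2 ab card_ord -/A; lia.
exists (fun j => enum_val (cast_ord cA j)); split=> //.
- by move=> i j /enum_val_inj/cast_ord_inj.
- by move=> j; have := enum_valP (cast_ord cA j); rewrite !inE negb_or.
move=> i ia ib; have iA : i \in A by rewrite !inE negb_or ia.
by exists (cast_ord (esym cA) (enum_rank_in iA i)); rewrite cast_ordKV enum_rankK_in.
Qed.

Lemma big_frame_compl a b h (V : Type) (idx : V) (op : Monoid.com_law idx)
    (F : 'I_(n + 3) -> V) : frame a b h ->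
  \big[op/idx]_(i | (i != a) && (i != b)) F i = \big[op/idx]_j F (h j).
Proof.
move=> [_ inj hab sur].
rewrite -(big_imset _ (h := h) (A := predT)) /=; last by move=> ? ? _ _; apply: inj.
apply: eq_bigl => i; apply/idP/imsetP => [/andP[ia ib]|[j _ ->]]; last exact: hab.
by have [j ->] := sur i ia ib; exists j.
Qed.

Lemma big_frame a b h (V : Type) (idx : V) (op : Monoid.com_law idx)
    (F : 'I_(n + 3) -> V) : frame a b h ->
  \big[op/idx]_i F i = op (op (F a) (F b)) (\big[op/idx]_j F (h j)).
Proof.
move=> fr; have [ab _ _ _] := fr.
rewrite (bigD1 a) //= (bigD1 b) /=; last by rewrite eq_sym.
by rewrite (big_frame_compl _ _ fr) Monoid.mulmA.
Qed.

(** Nonzero coordinates and pairwise distinct ratios x_j / y_j: general position relative to the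
    coordinate points, in a form visibly stable under inversion of coordinates. *)
Definition torus_pair (x y : point) :=
  [/\ forall j, x 0 j != 0, forall j, y 0 j != 0 &
      forall i j, i != j -> x 0 i * y 0 j != x 0 j * y 0 i].

Lemma lgp_frame a b h (q : 'I_(n + 3) -> point) :
  frame a b h -> (forall j, q (h j) = delta_mx 0 j) ->
  lgp q <-> torus_pair (q a) (q b).
Proof.
move=> fr qh.
(* The j-th coordinate point lies on the hyperplane v exactly when v_j = 0. *)
have cnt (v : 'cV[K]_n.+1) : #|[set i | (q i *m v == 0)%R]| =
    ((q a *m v == 0)%R + (q b *m v == 0)%R + #|[set j | (v j 0 == 0)%R]|)%N.
  rewrite -sum1_card big_mkcond /= (big_frame _ _ fr); congr (_ + _)%N.
    by rewrite !inE; congr (_ + _)%N; case: eqP.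
  rewrite -sum1_card [RHS]big_mkcond /=; apply: eq_bigr => j _.
  rewrite !inE qh -rowE; congr (if _ then _ else _).
  apply/eqP/eqP => [/rowP/(_ 0)|h0]; first by rewrite !mxE.
  by apply/rowP => k; rewrite !mxE !ord1.
have mul0 (x : point) (v : 'cV[K]_n.+1) : (x *m v == 0) = (\sum_j x 0 j * v j 0 == 0).
  apply/eqP/eqP => [/matrixP/(_ 0 0)|h0]; first by rewrite !mxE.
  by apply/matrixP => i j; rewrite !mxE !ord1.
split=> [hq|[x0 y0 xy] v v0].
  have xy0 j : (q a 0 j != 0) && (q b 0 j != 0).
    have dj v0 : (q v0 *m (delta_mx j 0 : 'cV[K]_n.+1) == 0) = (q v0 0 j == 0).
      by rewrite -colE; apply/eqP/eqP => [/matrixP/(_ 0 0)|h0]; [rewrite !mxE|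
        apply/matrixP => i k; rewrite !mxE !ord1].
    have d0 : (delta_mx j 0 : 'cV[K]_n.+1) != 0.
      by apply/eqP => /matrixP/(_ j 0)/eqP; rewrite !mxE !eqxx oner_eq0.
    have := hq _ d0; rewrite cnt !dj.
    have -> : [set k | ((delta_mx j 0 : 'cV[K]_n.+1) k 0 == 0)%R] = [set~ j].
      by apply/setP => k; rewrite !inE mxE eqxx andbT; case: (k == j); rewrite ?oner_eq0 ?eqxx.
    by rewrite cardsC1 card_ord /= -[X in (_ <= X)%N]add0n leq_add2r; do 2! case: (_ == 0).
  split=> [j|j|i j ij]; [by case/andP: (xy0 j) | by case/andP: (xy0 j) |].
  (* This hyperplane contains the point a and all coordinate points but the i-th and j-th, hence
     already n points; so it misses b. *)
  pose v : 'cV[K]_n.+1 := q a 0 j *: delta_mx i 0 - q a 0 i *: delta_mx j 0.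
  have vE k : v k 0 = q a 0 j * (k == i)%:R - q a 0 i * (k == j)%:R.
    by rewrite !mxE eqxx !andbT.
  have v0 : v != 0.
    apply/eqP => /matrixP/(_ i 0)/eqP; rewrite vE eqxx (negPf ij) mxE mulr1 mulr0 subr0.
    by apply/negP; case/andP: (xy0 j).
  have vx (x : point) : \sum_k x 0 k * v k 0 = q a 0 j * x 0 i - q a 0 i * x 0 j.
    under eq_bigr => k _ do rewrite vE mulrBr.
    rewrite sumrB (bigD1 i) //= big1 => [|k /negPf ->]; last by rewrite !mulr0.
    rewrite (bigD1 j) //= big1 => [|k /negPf ->]; last by rewrite !mulr0.
    by rewrite !eqxx !mulr1; ring.
  have := hq _ v0; rewrite cnt !mul0 !vx.
  have -> : q a 0 j * q a 0 i - q a 0 i * q a 0 j == 0 by rewrite mulrC subrr.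
  apply: contraTneq => E; rewrite -ltnNge.
  have -> : q a 0 j * q b 0 i - q a 0 i * q b 0 j == 0 by rewrite E subrr.
  suff : (#|~: [set i; j]| <= #|[set k | (v k 0 == 0)%R]|)%N.
    have := cardsC [set i; j]; rewrite cards2 ij card_ord /=; lia.
  apply: subset_leq_card; apply/subsetP => k; rewrite !inE negb_or vE => /andP[/negPf -> /negPf ->].
  by rewrite !mulr0 subrr.
rewrite cnt.
set S := [set j | v j 0 != 0].
have -> : [set j | (v j 0 == 0)%R] = ~: S by apply/setP => j; rewrite !inE negbK.
have cS := cardsC S; rewrite card_ord in cS.
have sumS (x : point) : \sum_j x 0 j * v j 0 = \sum_(j in S) x 0 j * v j 0.
  rewrite [RHS]big_mkcond; apply: eq_bigr => j _; rewrite inE.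
  by case: eqP => //= ->; rewrite mulr0.
rewrite !mul0 !sumS.
have S0 : (0 < #|S|)%N.
  rewrite card_gt0; apply: contra_neq v0 => S0; apply/matrixP => j k.
  by rewrite ord1 mxE; apply/eqP; move/setP/(_ j): S0; rewrite !inE => /negbFE.
have -> : #|~: S| = (n.+1 - #|S|)%N by lia.
(* With one nonzero coordinate, v misses both a and b. With at least three, the count is at most 2 +
   (n + 1 - 3). With exactly two, distinct ratios prevent v from containing both a and b. *)
case: (ltngtP #|S| 2) => [S1|S3|/eqP/cards2P[i [j [ij SE]]]].
- have c1 : #|S| = 1%N by lia.
  have /cards1P[j SE] : #|S| == 1%N by rewrite c1.
  rewrite c1.
  have : j \in S by rewrite SE inE.
  rewrite inE => vj; rewrite SE !big_set1 !mulf_eq0 (negPf vj) (negPf (x0 j)) (negPf (y0 j)) /= subSS subn0.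
  by [].
- have le2 : (2 + (n.+1 - #|S|) <= n)%N by lia.
  by apply: leq_trans le2; rewrite leq_add2r; apply: (@leq_add _ _ 1 1); exact: leq_b1.
have : i \in S by rewrite SE !inE eqxx.
rewrite inE => vi; have cS2 : #|S| = 2 by rewrite SE cards2 ij.
have n0 : (0 < n)%N by lia.
rewrite cS2.
rewrite SE !big_setU1 ?inE //= !big_set1.
suff : ~~ ((q a 0 i * v i 0 + q a 0 j * v j 0 == 0) && (q b 0 i * v i 0 + q b 0 j * v j 0 == 0)).
  by case: (q a 0 i * v i 0 + q a 0 j * v j 0 == 0);
    case: (q b 0 i * v i 0 + q b 0 j * v j 0 == 0) => //= _;
    rewrite subSS subn1 ?add0n ?addn0 ?add1n ?prednK ?leq_pred.
apply/negP => /andP[/eqP E1 /eqP E2]; have := xy i j ij; rewrite -subr_eq0.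
have : (q a 0 i * q b 0 j - q a 0 j * q b 0 i) * v i 0 = 0.
  transitivity (q b 0 j * (q a 0 i * v i 0 + q a 0 j * v j 0) -
                q a 0 j * (q b 0 i * v i 0 + q b 0 j * v j 0)); first by ring.
  by rewrite E1 E2 !mulr0 subrr.
by move/eqP; rewrite mulf_eq0 (negPf vi) orbF => ->.
Qed.

Lemma torus_pairV (x y : point) :
  torus_pair x y -> torus_pair (\row_i (x 0 i)^-1) (\row_i (y 0 i)^-1).
Proof.
move=> [x0 y0 xy]; split=> [j|j|i j ij]; rewrite !mxE ?invr_eq0 //.
by rewrite -!invfM (inj_eq (can_inj (@invrK K))); apply: xy.
Qed.

Lemma lgp_mul (p : 'I_(n + 3) -> point) (B : 'M[K]_n.+1) :
  B \in unitmx -> lgp p -> lgp (fun i => p i *m B).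
Proof.
move=> uB hp v v0; have Bv0 : B *m v != 0.
  by apply: contra_neq v0 => E; rewrite -[v](mulKmx uB) E mulmx0.
apply: leq_trans (hp _ Bv0); apply: eq_leq; apply: eq_card => i.
by rewrite !inE mulmxA.
Qed.

Lemma frame_basis a b h (p : 'I_(n + 3) -> point) : lgp p -> frame a b h ->
  exists2 B : 'M[K]_n.+1, B \in unitmx & forall j, p (h j) = delta_mx 0 j *m B.
Proof.
move=> hp [_ inj _ _]; pose B : 'M[K]_n.+1 := \matrix_j p (h j).
exists B => [|j]; last by rewrite -rowE rowK.
rewrite -unitmx_tr -row_free_unit -kermx_eq0; apply/negPn/negP => ker0.
have /rowV0Pn[v /sub_kermxP vB v0] := ker0.
have vT0 : v^T != 0 by apply: contra_neq v0 => E; rewrite -[v]trmxK E trmx0.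
have := hp _ vT0; rewrite leqNgt => /negP; apply.
have cn : #|h @: predT| = n.+1 by rewrite card_imset // cardT size_enum_ord.
apply: leq_trans (eq_leq (esym cn)) _.
apply: subset_leq_card; apply/subsetP => _ /imsetP[j _ ->]; rewrite inE.
have : B *m v^T = 0 by rewrite -[B]trmxK -trmx_mul vB trmx0.
by move/(congr1 (row j)); rewrite row_mul row0 rowK => ->.
Qed.

End Configurations.

(** * Necessity of the degree inequalities, by Cremona maps *)

Section LowerBound.
Variables (K : fieldType) (n : nat).
Local Notation point := 'rV[K]_n.+1.

Definition form_through (p : 'I_(n + 3) -> point) D (d : 'I_(n + 3) -> nat) :=
  exists f : {mpoly K[n.+1]},
    [/\ f != 0, f \is D.-homog & forall i, ldeg_le (p i) (d i) f].

Lemma form_through_mul (p : 'I_(n + 3) -> point) (B : 'M[K]_n.+1) D d :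
  B \in unitmx -> form_through p D d <-> form_through (fun i => p i *m B) D d.
Proof.
move=> uB; split=> [] [f [f0 fD fd]].
  exists (linsub (invmx B) f); split; first by rewrite linsub_neq0 ?unitmx_inv.
    exact: linsub_homog.
  by move=> i; apply: ldeg_linsub; rewrite mulmxK //; apply: fd.
exists (linsub B f); split; [exact: linsub_neq0 | exact: linsub_homog |].
by move=> i; apply: ldeg_linsub; apply: fd.
Qed.

(** Inversion of the coordinates in the frame that omits a and b. The relations are equations
    between natural numbers, so they also record that the new degree and line degrees are
    nonnegative; necessity rests on this. *)
Lemma cremona_step (p : 'I_(n + 3) -> point) (a b : 'I_(n + 3)) D d :
  (0 < n)%N -> lgp p -> a != b -> form_through p D d ->
  exists p' D' d', [/\ lgp p', form_through p' D' d',
    (D + D' = \sum_(i | (i != a) && (i != b)) d i)%N,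
    forall i, i != a -> i != b -> d' i = d i &
    (d' a + D = D' + d a)%N /\ (d' b + D = D' + d b)%N].
Proof.
move=> n0 hp ab; have [h fr] := frame_exists ab.
have [B uB pB] := frame_basis hp fr.
have uB' : invmx B \in unitmx by rewrite unitmx_inv.
move=> /(form_through_mul _ _ _ uB').
have {hp} := lgp_mul uB' hp.
set q := fun i => _ => hq [f [f0 fD fd]].
have qh j : q (h j) = delta_mx 0 j by rewrite /q pB mulmxK.
have [qa0 qb0 qab] := (lgp_frame fr qh).1 hq.
have [_ inj hab sur] := fr.
(* At the coordinate points line degrees are exponents: every monomial of f divides X^e. *)
pose e : 'X_{1..n.+1} := [multinom d (h j) | j < n.+1].
have le_e m : m \in msupp f -> (m <= e)%MM.
  move=> mf; apply/mnm_lepP => j; rewrite mnmE.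
  by have := fd (h j); rewrite qh => /ldeg_deltaP; apply.
pose D' := (mdeg e - D)%N.
have DD : (D + D' = mdeg e)%N.
  have [m mf] : exists m, m \in msupp f.
    by move: f0; rewrite -msupp_eq0; case: (msupp f) => // m s _; exists m; rewrite mem_head.
  rewrite /D' subnKC // -(dhomogP _ _ _ fD m mf) /= !mdegE.
  by apply: leq_sum => j _; have /mnm_lepP/(_ j) := le_e m mf.
have eE : mdeg e = (\sum_(i | (i != a) && (i != b)) d i)%N.
  by rewrite mdegE (big_frame_compl _ _ fr); apply: eq_bigr => j _; rewrite mnmE.
pose g := cremona e f.
have g0 : g != 0 by apply: cremona_neq0.
pose inv (x : point) : point := \row_i (x 0 i)^-1.
pose p' i := if (i == a) || (i == b) then inv (q i) else q i.
pose d' i := if (i == a) || (i == b) then (D' + d i - D)%N else d i.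
have tor c : (c == a) || (c == b) ->
    (size (translate (inv (q c)) g) + D <= (D' + d c).+1)%N.
  move=> hc; have qc0 j : q c 0 j != 0 by case/orP: hc => /eqP ->.
  have := ldeg_cremona_torus n0 qc0 f0 fD le_e (fd c).
  rewrite -/(inv _) -/g; move: (size _) => s; lia.
(* Since g is nonzero, its translate has positive size; so the truncated subtraction in [d'] is
   exact. *)
have tor0 c : (c == a) || (c == b) -> (D <= D' + d c)%N.
  move=> /tor; have : (0 < size (translate (inv (q c)) g))%N.
    by rewrite size_poly_gt0 translate_eq0.
  by move: (size _) => s; lia.
have p'h j : p' (h j) = delta_mx 0 j.
  by rewrite /p'; have /andP[/negPf -> /negPf ->] := hab j; apply: qh.
have aa : (a == a) || (a == b) by rewrite eqxx.
have bb : (b == a) || (b == b) by rewrite eqxx orbT.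
exists p', D', d'; split=> //.
- apply/(lgp_frame fr p'h); rewrite /p' aa bb; apply: torus_pairV; split=> //.
- exists g; split=> //; first exact: cremona_homog.
  move=> i; rewrite /ldeg_le /p' /d'; case: ifP => [hi|/negbT].
    rewrite -subSn; last exact: tor0.
    by rewrite -(addnK D (size _)); apply: leq_sub2r; exact: tor.
  rewrite negb_or => /andP[ia ib]; have [j ->] := sur i ia ib; rewrite qh.
  by have := ldeg_cremona_delta e f j; rewrite mnmE.
- by rewrite DD.
- by move=> i /negPf ia /negPf ib; rewrite /d' ia ib.
by rewrite /d' aa bb !subnK //; apply: tor0.
Qed.

(** One map gives D' = (n + 1) e - D, and the new line degree at a is (n + 2) e - 2 D, which is
    nonnegative. *)
Lemma form_through_even p D e : (0 < n)%N -> lgp p ->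
  form_through p D (fun=> e) -> (2 * D <= (n + 2) * e)%N.
Proof.
move=> n0 hp; have [a [b ab]] : exists a b : 'I_(n + 3), a != b.
  have l0 : (0 < n + 3)%N by lia.
  have l1 : (1 < n + 3)%N by lia.
  by exists (Ordinal l0), (Ordinal l1).
move=> /(cremona_step n0 hp ab)[p' [D' [d' [_ _ E _ [E' _]]]]].
have [h fr] := frame_exists ab.
by rewrite (big_frame_compl _ _ fr) sum_nat_const card_ord in E; nia.
Qed.

(* Cremona maps centred at the complements of disjoint pairs of points shift the
   degree and the line degrees by the same amount [(n + 1) e - 2 D]. *)
Lemma form_through_iter p D e t : (0 < n)%N -> (2 * t <= n + 3)%N -> lgp p ->
  form_through p D (fun=> e) ->
  exists p' D' d', [/\ lgp p', form_through p' D' d',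
    (D' + 2 * t * D = D + t * n.+1 * e)%N &
    forall i, (d' i + 2 * (i < 2 * t) * D = e + (i < 2 * t) * n.+1 * e)%N].
Proof.
move=> n0; elim: t => [|t IH] ht hp hD; first by exists p, D, (fun=> e).
have [|p1 [D1 [d1 [hp1 h1 E1 F1]]]] := IH _ hp hD; first by lia.
have la : (2 * t < n + 3)%N by lia.
have lb : ((2 * t).+1 < n + 3)%N by lia.
pose a := Ordinal la; pose b := Ordinal lb.
have ab : a != b by rewrite -val_eqE /=; lia.
have [p2 [D2 [d2 [hp2 h2 E2 G2 [Ha Hb]]]]] := cremona_step n0 hp1 ab h1.
have Fa := F1 a; have Fb := F1 b.
(* Put s = (n + 1) e - 2 D. The line degrees add up to (n + 3) e + 2 t s; subtracting those at a and
   b, both e, and D1 = D + t s leaves D2 = D + (t + 1) s. *)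
have S : (\sum_i d1 i + 4 * t * D = (n + 3) * e + 2 * t * n.+1 * e)%N.
  have c2 : (\sum_(i < n + 3) (i < 2 * t) = 2 * t)%N.
    rewrite -[RHS]card_ord -sum1_card (big_ord_widen (n + 3) (fun=> 1%N)); last by lia.
    by rewrite [RHS]big_mkcond; apply: eq_bigr => i _; case: (_ < _)%N.
  transitivity (\sum_(i < n + 3) (e + (i < 2 * t) * n.+1 * e))%N; last first.
    by rewrite big_split /= sum_nat_const card_ord -!big_distrl /= c2.
  under [RHS]eq_bigr => i _ do rewrite -F1.
  by rewrite big_split /= -!big_distrl /= -big_distrr /= c2 mulnA.
have S2 : (\sum_i d1 i = d1 a + d1 b + (D1 + D2))%N.
  rewrite (bigD1 a) //= (bigD1 b) /=; last by rewrite eq_sym.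
  by rewrite addnA E2.
have sa : (a < 2 * t)%N = false by rewrite /=; lia.
have sb : (b < 2 * t)%N = false by rewrite /=; lia.
rewrite sa in Fa; rewrite sb in Fb.
exists p2, D2, d2; split=> //; first by nia.
move=> i; have [->|ia] := eqVneq i a.
  have -> : (a < 2 * t.+1)%N = true by rewrite /=; lia.
  nia.
have [->|ib] := eqVneq i b.
  have -> : (b < 2 * t.+1)%N = true by rewrite /=; lia.
  nia.
rewrite G2 //; have -> : (i < 2 * t.+1)%N = (i < 2 * t)%N; last exact: F1.
by move: ia ib; rewrite -!val_eqE /=; lia.
Qed.

(** The (n + 3)/2 pairs exhaust the points, and the final degree D + (n + 3)/2 ((n + 1) e - 2 D) is
    nonnegative. *)
Lemma form_through_odd p D e : odd n -> lgp p -> form_through p D (fun=> e) ->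
  (2 * (n + 2) * D <= (n + 1) * (n + 3) * e)%N.
Proof.
move=> on hp hD; have n0 : (0 < n)%N by case: (n) on.
have E : ((n + 3)./2 * 2 = n + 3)%N by rewrite muln2 -[RHS]odd_double_half oddD on.
have [|p' [D' [d' [_ _ E' _]]]] := form_through_iter (t := (n + 3)./2) n0 _ hp hD.
  by lia.
by nia.
Qed.

End LowerBound.

(** * Determinantal cones *)

(** The matrix is a Schur complement in the bordered matrix [B], where T occurs only in the first
    column; expansion along that column has degree at most 1 in T. *)
Lemma size_det_rank1 (A : comNzRingType) (r : nat) (C : 'M[A]_r)
    (x : 'cV[A]_r) (y : 'rV[A]_r) :
  (size (\det (map_mx polyC C + 'X *: map_mx polyC (x *m y)))%R <= 2)%N.
Proof.
set x' := map_mx polyC x; set y' := map_mx polyC y; set C' := map_mx polyC C.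
pose B : 'M_(1 + r) := block_mx 1%:M (- y') ('X *: x') C'.
have -> : \det (C' + 'X *: map_mx polyC (x *m y)) = \det B.
  have -> : B = block_mx 1%:M 0 ('X *: x') 1%:M *m
      block_mx 1%:M (- y') 0 (C' + 'X *: map_mx polyC (x *m y)).
    rewrite mulmx_block !mul1mx !mul0mx ?mulmx0 !mulmx1 ?addr0.
    by rewrite map_mxM mulmxN -scalemxAl addrCA addNr addr0.
  by rewrite det_mulmx det_lblock det_ublock !det1 !mul1r.
rewrite (expand_det_col B 0).
apply: leq_trans (size_sum _ _ _) _; apply/bigmax_leqP => i _.
rewrite /cofactor; have -> : row' i (col' 0 B) =
    map_mx polyC (row' i (col' 0 (block_mx 1%:M (- y) 0 C : 'M_(1 + r)))).
  apply/matrixP => s t; rewrite mxE [LHS]mxE [RHS]mxE [X in X%:P]mxE [X in X%:P]mxE -!rshift1.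
  case: (split_ordP (lift i s)) => s' ->.
    rewrite [LHS](block_mxEur _ (- y') _ _ s' t).
    by rewrite [X in X%:P](block_mxEur _ (- y) _ _ s' t) !mxE polyCN.
  rewrite [LHS](block_mxEdr _ _ _ C' s' t).
  by rewrite [X in X%:P](block_mxEdr _ _ _ C s' t) !mxE.
rewrite det_map_mx -(rmorph_sign polyC) -polyCM mulrC mul_polyC.
apply: leq_trans (size_scale_leq _ _) _.
have -> : B i 0 = B i (lshift r 0) by congr (B _ _); apply: val_inj.
have [i0 ->|i0 ->] := split_ordP i.
  by rewrite [B _ _](block_mxEul _ _ _ _ i0 0) !mxE ord1 eqxx size_poly1.
rewrite [B _ _](block_mxEdl _ _ _ _ i0 0) !mxE mulrC mul_polyC.
by rewrite (leq_trans (size_scale_leq _ _)) ?size_polyX.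
Qed.

(** Up to scaling, v consists of the weights of the divided difference at the nodes b, which
    annihilates polynomials of degree below k. *)
Lemma vandermonde_weights (K : fieldType) (k : nat) (b : 'I_k.+1 -> K) :
  injective b ->
  exists v : 'I_k.+1 -> K, (forall j, v j != 0) /\
    forall t, (t < k)%N -> \sum_j v j * b j ^+ t = 0.
Proof.
move=> inj; pose V : 'M[K]_(k.+1, k) := \matrix_(j, t) b j ^+ t.
have : kermx V != 0.
  by rewrite kermx_eq0 -row_leq_rank -ltnNge ltnS rank_leq_col.
move=> /rowV0Pn[v /sub_kermxP vV v0].
have vt t : (t < k)%N -> \sum_j v 0 j * b j ^+ t = 0.
  move=> tk; have /matrixP/(_ 0 (Ordinal tk)) := vV; rewrite !mxE => E.
  by rewrite -[RHS]E; apply: eq_bigr => j _; rewrite mxE.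
exists (v 0); split=> // i0; apply: contra_neq v0 => vi0.
have vG (G : {poly K}) : (size G <= k)%N -> \sum_j v 0 j * G.[b j] = 0.
  move=> sG; under eq_bigr => j _ do rewrite (horner_coef_wide _ sG) mulr_sumr.
  rewrite exchange_big /= big1 // => t _.
  under eq_bigr => j _ do rewrite mulrCA.
  by rewrite -mulr_sumr vt ?mulr0.
apply/matrixP => o i; rewrite ord1 mxE; apply/eqP.
have [->|ii0] := eqVneq i i0; first by rewrite vi0.
(* [G] has degree k - 1 and vanishes at every node but i0 and i. If v vanishes at i0, testing v on
   [G] leaves v_i G(b_i) = 0. *)
pose G := \prod_(j in predC (pred2 i0 i)) ('X - (b j)%:P).
have sG : (size G <= k)%N.
  rewrite /G -big_enum /= size_prod_XsubC -cardE.
  have := cardC (pred2 i0 i); rewrite card2 card_ord eq_sym ii0 add2n => - [E].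
  by apply: leq_trans (eq_leq E).
have := vG _ sG; rewrite (bigD1 i) //= big1 => [|j ji]; last first.
  have [->|ji0] := eqVneq j i0; first by rewrite vi0 mul0r.
  by rewrite /G (bigD1 j) ?inE ?negb_or ?ji0 //= hornerM hornerXsubC subrr mul0r mulr0.
rewrite addr0 => /eqP; rewrite mulf_eq0 => /orP[//|].
rewrite /G horner_prod => /prodf_eq0[j].
rewrite !inE negb_or => /andP[_ ji].
by rewrite !hornerE subr_eq0 => /eqP/inj/eqP; rewrite eq_sym (negPf ji).
Qed.
Lemma homog_det (K : fieldType) (N r : nat) (M : 'M[{mpoly K[N]}]_r) :
  (forall i j, M i j \is 1.-homog) -> \det M \is r.-homog.
Proof.
move=> hM; rewrite /determinant; apply: rpred_sum => s _.
rewrite -(rmorph_sign (@mpolyC N K)) mul_mpolyC; apply: dhomogZ.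
suff : \prod_i M i (perm.fun_of_perm s i) \is (\sum_(i < r) 1)%N.-homog.
  by rewrite sum1_card card_ord.
apply: (big_ind2 (fun (g : {mpoly K[N]}) (d : nat) => g \is d.-homog)) => //.
  exact: dhomog1.
by move=> ? ? ? ?; apply: dhomogM.
Qed.

Lemma translate_det (K : fieldType) (N r : nat) (p : 'rV[K]_N) (M : 'M_r) :
  translate p (\det M) = \det (map_mx (translate p) M).
Proof. by rewrite det_map_mx. Qed.

Section Cone.
Variables (K : fieldType) (n r : nat) (g : 'I_(2 * r).+1 -> 'I_n.+1).
Variables (w b : 'I_(2 * r).+1 -> K).

(* A Hankel matrix: the combination of the symmetric rank one matrices
   (b^(s + t))_(s, t) with coefficients w X. *)
Definition hankel : 'M[{mpoly K[n.+1]}]_r.+1 :=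
  \matrix_(s, t) \sum_j (w j * b j ^+ (s + t))%:MP * 'X_(g j).

Lemma hankel_homog : \det hankel \is r.+1.-homog.
Proof.
apply: homog_det => s t; rewrite mxE; apply: rpred_sum => j _.
by rewrite mul_mpolyC; apply: dhomogZ; rewrite dhomogX /= mdeg1.
Qed.

Lemma ldeg_hankel_rank1 (p : 'rV[K]_n.+1) (x : 'cV[K]_r.+1) (y : 'rV[K]_r.+1) :
  (forall s t : 'I_r.+1, \sum_j p 0 (g j) * (w j * b j ^+ (s + t)) = x s 0 * y 0 t) ->
  ldeg_le p 1 (\det hankel).
Proof.
move=> hxy; rewrite /ldeg_le translate_det.
have -> : map_mx (translate p) hankel =
    map_mx polyC hankel + 'X *: map_mx polyC (map_mx (@mpolyC _ _) x *m map_mx (@mpolyC _ _) y).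
  apply/matrixP => s t; rewrite !mxE big_ord1 !mxE -mpolyCM -hxy !rmorph_sum /=.
  rewrite mulr_sumr -big_split; apply: eq_bigr => j _ /=.
  by rewrite !rmorphM /= !translateC translateXU -mul_polyC; ring.
exact: size_det_rank1.
Qed.

(** Such a point lies in the vertex of the cone: translation along it changes no entry of the
    matrix. *)
Lemma ldeg_hankel_rank0 (p : 'rV[K]_n.+1) :
  (forall j, p 0 (g j) = 0) -> ldeg_le p 0 (\det hankel).
Proof.
move=> hp; rewrite /ldeg_le translate_det.
have -> : map_mx (translate p) hankel = map_mx polyC hankel.
  apply/matrixP => s t; rewrite !mxE !rmorph_sum; apply: eq_bigr => j _ /=.
  by rewrite !rmorphM /= !translateC translateXU hp mpolyC0 scale0r addr0.
by rewrite det_map_mx size_polyC leq_b1.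
Qed.

Lemma hankel_neq0 : injective g -> injective b -> (forall j, w j != 0) ->
  \det hankel != 0.
Proof.
move=> ginj binj w0.
have lr : (r.+1 <= (2 * r).+1)%N by lia.
(* Setting the first r + 1 chosen variables to 1 and all others to 0 turns the matrix into V
   diag(w') V^T, with V a Vandermonde matrix. *)
pose x i : K := [exists j : 'I_(2 * r).+1, (g j == i) && (j < r.+1)%N]%:R.
have xg j : x (g j) = (j < r.+1)%:R.
  rewrite /x; congr (_%:R); congr nat_of_bool.
  by apply/existsP/idP => [[j' /andP[/eqP/ginj -> //]]|h]; exists j; rewrite eqxx.
pose b' : 'rV[K]_r.+1 := \row_j b (widen_ord lr j).
pose w' : 'rV[K]_r.+1 := \row_j w (widen_ord lr j).
have E : (\det hankel).@[x] =
    \det (Vandermonde r.+1 b' *m diag_mx w' *m (Vandermonde r.+1 b')^T).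
  rewrite -det_map_mx; congr (\det _); apply/matrixP => s t; rewrite !mxE rmorph_sum /=.
  transitivity (\sum_(j < (2 * r).+1 | (j < r.+1)%N) w j * b j ^+ (s + t)).
    rewrite [RHS]big_mkcond; apply: eq_bigr => j _ /=.
    by rewrite mevalM mevalC mevalXU xg; case: (_ < _)%N; rewrite ?mulr1 ?mulr0.
  rewrite (big_ord_narrow lr); apply: eq_bigr => j _.
  by rewrite mul_mx_diag !mxE exprD; ring.
apply: contraTneq isT => det0; move: E; rewrite det0 rmorph0 !det_mulmx det_tr det_diag det_Vandermonde.
move/esym/eqP; rewrite !mulf_eq0 orbAC orbb => /orP[] /prodf_eq0[i _].
  move=> /prodf_eq0[j ij]; rewrite !mxE subr_eq0 => /eqP/binj/(congr1 val) /= E.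
  by rewrite E ltnn in ij.
by rewrite mxE (negPf (w0 _)).
Qed.

End Cone.

(** * Sufficiency: products of determinantal cones *)

Section Existence.
Variables (K : fieldType) (n : nat) (p : 'I_(n + 3) -> 'rV[K]_n.+1).

Lemma form_throughM D D' d d' : form_through p D d -> form_through p D' d' ->
  form_through p (D + D') (fun i => d i + d' i)%N.
Proof.
move=> [f [f0 fD fd]] [g [g0 gD gd]]; exists (f * g); split.
- by rewrite mulf_neq0.
- exact: dhomogM.
by move=> i; apply: ldeg_leM.
Qed.

Lemma form_throughW D d d' : (forall i, d i <= d' i)%N ->
  form_through p D d -> form_through p D d'.
Proof.
by move=> dd [f [f0 fD fd]]; exists f; split=> // i; apply: ldeg_leW (dd i) (fd i).
Qed.

Lemma form_through0 d : form_through p 0 d.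
Proof. by exists 1; split; [exact: oner_neq0 | exact: dhomog1 | move=> i; exact: ldeg_le1]. Qed.

Hypothesis hp : lgp p.

(** A Hankel determinant in 2 r + 1 coordinates is fitted to the points: its matrix has rank at most
    one at a, at b and at the chosen coordinate points, and is zero at the remaining ones. *)
Lemma form_through_cone r (A : {set 'I_(n + 3)}) : (2 * r + 3 <= #|A|)%N ->
  form_through p r.+1 (fun i => i \in A).
Proof.
move=> cA; have /card_gt1P[a [b [aA bA ab]]] : (1 < #|A|)%N by lia.
have [h fr] := frame_exists ab; have [_ hinj hab sur] := fr.
have [B uB pB] := frame_basis hp fr.
have uB' : invmx B \in unitmx by rewrite unitmx_inv.
apply/(form_through_mul _ _ _ uB').
have := lgp_mul uB' hp; set q := fun i => _ => hq.
have qh j : q (h j) = delta_mx 0 j by rewrite /q pB mulmxK.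
have [qa0 qb0 qab] := (lgp_frame fr qh).1 hq.
pose J := [set j | h j \in A].
have cJ : (2 * r < #|J|)%N.
  have : #|A| = (2 + #|J|)%N.
    rewrite -sum1_card big_mkcond (big_frame _ _ fr) /= aA bA; congr (_ + _)%N.
    by rewrite -sum1_card [RHS]big_mkcond; apply: eq_bigr => j _; rewrite inE.
  by move: cA => /[swap] ->; lia.
pose g (j : 'I_(2 * r).+1) := enum_val (widen_ord cJ j).
have ginj : injective g.
  by move=> i j /enum_val_inj/(congr1 val) /= ij; apply: val_inj.
have gA j : h (g j) \in A by have := enum_valP (widen_ord cJ j); rewrite inE.
pose c j := q a 0 (g j) / q b 0 (g j).
have c0 j : c j != 0 by rewrite mulf_neq0 ?invr_eq0.
have cinj : injective c.
  move=> i j /eqP; rewrite eqr_div ?qb0 // => ij; apply: ginj; apply/eqP.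
  by apply: contraTT ij => /qab.
have [v [v0 vS]] := vandermonde_weights cinj.
(* With these weights and the nodes c_j = a_j / b_j, the entry (s, t) is the moment of v of order s
   + t at a, and of order s + t - 1 at b. *)
pose w j := v j / q a 0 (g j).
have wa j : q a 0 (g j) * w j = v j by rewrite /w mulrC divfK.
have wb j : q b 0 (g j) * w j = v j / c j by rewrite /w /c invf_div; ring.
exists (\det (hankel g w c)); split.
- by apply: hankel_neq0 => // j; rewrite mulf_neq0 ?invr_eq0.
- exact: hankel_homog.
move=> i; have [->|ia] := eqVneq i a.
  (* Moments of order below 2 r vanish, so only the corner s = t = r survives. *)
  rewrite aA; pose C := \sum_j v j * c j ^+ (2 * r).
  apply: (@ldeg_hankel_rank1 _ _ _ _ _ _ _ (\col_s (C * (s == ord_max)%:R))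
    (\row_t (t == ord_max)%:R)) => s t.
  under eq_bigr => j _ do rewrite mulrA wa.
  rewrite !mxE; have [->|sr] := eqVneq s ord_max; have [->|tr] := eqVneq t ord_max.
  - by rewrite /= -[X in (X + X)%N]mul1n -mulnDl !mulr1.
  - rewrite mulr0 vS //; move: tr; rewrite -val_eqE /=; have := ltn_ord t; lia.
  - rewrite mulr0 mul0r vS //; move: sr; rewrite -val_eqE /=; have := ltn_ord s; lia.
  - rewrite mulr0 vS //; move: sr; rewrite -val_eqE /=; have := ltn_ord s; have := ltn_ord t; lia.
have [->|ib] := eqVneq i b.
  (* Unless s = t = 0, the order s + t - 1 lies between 0 and 2 r - 1; only this corner survives. *)
  rewrite bA; pose C := \sum_j v j / c j.
  apply: (@ldeg_hankel_rank1 _ _ _ _ _ _ _ (\col_s (C * (s == ord0)%:R))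
    (\row_t (t == ord0)%:R)) => s t.
  under eq_bigr => j _ do rewrite mulrA wb.
  rewrite !mxE -!val_eqE /=; case E : (s + t)%N => [|u].
    have -> : s = 0%N :> nat by lia.
    have -> : t = 0%N :> nat by lia.
    by rewrite !mulr1; apply: eq_bigr => j _; rewrite mulr1.
  transitivity (\sum_j v j * c j ^+ u).
    by apply: eq_bigr => j _; rewrite exprS mulrA divfK.
  rewrite vS; last by have := ltn_ord s; have := ltn_ord t; lia.
  case: eqP => [s0|_]; last by rewrite mulr0 mul0r.
  by case: eqP => [t0|_]; [rewrite s0 t0 in E | rewrite mulr0].
have [j0 ->] := sur i ia ib; rewrite qh.
have [/existsP[j1 /eqP <-]|] := boolP [exists j, g j == j0].
  rewrite gA; apply: (@ldeg_hankel_rank1 _ _ _ _ _ _ _ (\col_s (w j1 * c j1 ^+ s))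
    (\row_t c j1 ^+ t)) => s t.
  rewrite (bigD1 j1) //= big1 => [|j jj1]; last first.
    by rewrite mxE eqxx (inj_eq ginj) (negPf jj1) mul0r.
  by rewrite !mxE !eqxx mul1r addr0 exprD mulrA.
rewrite negb_exists => /forallP gj.
by apply: ldeg_leW (leq0n _) _; apply: ldeg_hankel_rank0 => j; rewrite mxE eqxx (negPf (gj j)).
Qed.

Lemma form_through_degree r : (2 * r <= n + 2)%N -> form_through p r (fun=> 1%N).
Proof.
case: r => [|r] hr; first exact: form_through0.
apply: form_throughW (@form_through_cone r [set: _] _); first by move=> i; exact: leq_b1.
by rewrite cardsT card_ord; lia.
Qed.

Lemma exists_form_even D e : ~~ odd n -> (2 * D <= (n + 2) * e)%N ->
  form_through p D (fun=> e).
Proof.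
move=> en; elim: e D => [|e IH] D hD.
  have -> : D = 0%N by lia.
  exact: form_through0.
have E := odd_double_half n; rewrite (negPf en) -muln2 in E.
(* n/2 + 1 is the largest degree available from [form_through_degree]; one such factor is split off
   for each unit of e. *)
pose r := minn (n./2.+1) D.
have h1 : form_through p r (fun=> 1%N) by apply: form_through_degree; rewrite /r; lia.
have h2 : form_through p (D - r) (fun=> e) by apply: IH; rewrite /r; nia.
have := form_throughM h1 h2; rewrite subnKC ?geq_minr //.
Qed.

Section Odd.
Variable (m : nat).
Hypotheses (m0 : (0 < m)%N) (nm : n.+1 = (2 * m)%N).

(** Each c in T contributes a cone of degree m with vertex at c, through the other n + 2 = 2 m + 1
    points. *)
Lemma form_through_cones (T : {set 'I_(n + 3)}) :
  form_through p (m * #|T|) (fun i => #|T :\ i|).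
Proof.
have [k le_k] := ubnP #|T|; elim: k T le_k => // k IH T; rewrite ltnS => le_k.
have [->|[c cT]] := set_0Vmem T; first by rewrite cards0 muln0; apply: form_through0.
have cE := cardsD1 c T; rewrite cT in cE.
have h1 : form_through p m (fun i => i \in ~: [set c]).
  rewrite -[X in form_through _ X]prednK //; apply: form_through_cone.
  by rewrite cardsC1 card_ord; lia.
have := form_throughM h1 (IH (T :\ c) _); rewrite cE mulnDr muln1 => h.
apply: (form_throughW _ (h _)) => [i|]; last by lia.
have [->|ic] := eqVneq i c; first by rewrite !inE eqxx setDDl setUid.
have := cardsD1 c (T :\ i); rewrite !inE eq_sym ic cT /= => ->.
by rewrite leq_add2l; apply: eq_leq; rewrite !setDDl setUC.
Qed.

Lemma exists_form_odd D e : (2 * (n + 2) * D <= (n + 1) * (n + 3) * e)%N ->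
  form_through p D (fun=> e).
Proof.
have -> : (2 * (n + 2) = 2 * (2 * m + 1))%N by lia.
have -> : ((n + 1) * (n + 3) = 2 * (2 * m * (m + 1)))%N by nia.
rewrite -!mulnA !leq_pmul2l //.
have [k le_k] := ubnP D; elim: k D e le_k => // k IH D e; rewrite ltnS => le_k hD.
have c3 : #|[set: 'I_(n + 3)]| = (2 * m + 2)%N by rewrite cardsT card_ord; lia.
(* The cones with vertices at all the points have a product of degree 2 m (m + 1) and line degree 2
   m + 1, which attains equality; it is split off while D allows. *)
have [big|small] := leqP (2 * m * (m + 1)) D.
  have e0 : (2 * m + 1 <= e)%N by nia.
  have h1 : form_through p (m * (2 * m + 2)) (fun=> (2 * m + 1)%N).
    rewrite -c3; apply: form_throughW (form_through_cones _) => i.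
    by have := cardsD1 i [set: 'I_(n + 3)]; rewrite in_setT c3 /= addnS add1n => - [->].
  have h2 : form_through p (D - m * (2 * m + 2)) (fun=> (e - (2 * m + 1))%N).
    by apply: IH; nia.
  have := form_throughM h1 h2.
  by rewrite subnKC; [rewrite /= subnKC | nia].
pose u := (D %/ m)%N; pose r := (D %% m)%N.
have DE : D = (m * u + r)%N by rewrite mulnC -divn_eq.
have rm : (r < m)%N by rewrite ltn_mod.
have um : (u < 2 * m + 2)%N by nia.
(* The cones with vertices in T use degree m u and line degree u, or u - 1 at the points of T; a
   degree r < m remains. *)
pose T := [set i : 'I_(n + 3) | (i < u)%N].
have cT : #|T| = u.
  have le : (u <= n + 3)%N by lia.
  rewrite -sum1_card -[RHS]card_ord -sum1_card (big_ord_widen _ (fun=> 1%N) le).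
  by apply: eq_bigl => i; rewrite inE.
have hT := form_through_cones T; rewrite cT in hT.
have sT i : (#|T :\ i| + (i \in T) = u)%N by rewrite addnC -cardsD1.
have [eu|ue] := ltnP u e.
  have h1 : form_through p r (fun=> 1%N) by apply: form_through_degree; lia.
  rewrite DE; apply: form_throughW (form_throughM hT h1) => i.
  by apply: leq_trans eu; rewrite addn1 ltnS -(sT i) leq_addr.
(* For e < u the inequality would force u >= 2 m + 2. *)
have eu : e = u by nia.
rewrite DE; have [->|r0] := posnP r.
  rewrite addn0 eu; apply: form_throughW hT => i.
  by rewrite -(sT i) leq_addr.
(* With e = u the inequality reads (2 m + 1) r <= m u, so u >= 2 r + 1. A cone of degree r through
   the points of T then uses exactly the line degree still free at them. *)
have ur : (2 * r + 1 <= u)%N by nia.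
have h1 : form_through p r.-1.+1 (fun i => i \in T).
  by apply: form_through_cone; rewrite cT; lia.
rewrite prednK // in h1.
by apply: form_throughW (form_throughM hT h1) => i; rewrite sT eu.
Qed.

End Odd.
End Existence.

(** * Powers of the ideal of a point *)

Section IdealPowers.
Variables (R : comNzRingType) (I : R -> Prop).

Lemma ideal_gen0 (S : R -> Prop) : ideal_gen S 0.
Proof. by exists 0%N, (fun=> 0), (fun=> 0); split=> [[]|] //; rewrite big_ord0. Qed.

Lemma ideal_genD (S : R -> Prop) f g :
  ideal_gen S f -> ideal_gen S g -> ideal_gen S (f + g).
Proof.
move=> [m1 [c1 [g1 [S1 ->]]]] [m2 [c2 [g2 [S2 ->]]]].
exists (m1 + m2)%N, (fun i => match split i with inl j => c1 j | inr j => c2 j end),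
  (fun i => match split i with inl j => g1 j | inr j => g2 j end).
split; first by move=> i; case: (split i).
rewrite big_split_ord /=; congr (_ + _); apply: eq_bigr => i _.
  by rewrite (unsplitK (inl _ i)).
by rewrite (unsplitK (inr _ i)).
Qed.

Lemma ideal_genM (S : R -> Prop) r f : ideal_gen S f -> ideal_gen S (r * f).
Proof.
move=> [m [c [g [Sg ->]]]]; exists m, (fun i => r * c i), g; split=> //.
by rewrite mulr_sumr; apply: eq_bigr => i _; rewrite mulrA.
Qed.

Lemma mem_ideal_gen (S : R -> Prop) f : S f -> ideal_gen S f.
Proof.
move=> Sf; exists 1%N, (fun=> 1), (fun=> f); split=> //.
by rewrite big_ord1 mul1r.
Qed.

Lemma ideal_gen_sum (S : R -> Prop) (T : Type) (r : seq T) (P : pred T) (F : T -> R) :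
  (forall i, P i -> ideal_gen S (F i)) -> ideal_gen S (\sum_(i <- r | P i) F i).
Proof. by move=> SF; apply: big_ind => //; [exact: ideal_gen0 | exact: ideal_genD]. Qed.

Lemma ideal_power0 f : ideal_power I 0 f.
Proof.
rewrite -[f]mulr1; apply: ideal_genM; apply: mem_ideal_gen.
by exists (fun=> 0); split=> [[]|] //; rewrite big_ord0.
Qed.

Lemma ideal_power1 f : I f -> ideal_power I 1 f.
Proof.
by move=> If; apply: mem_ideal_gen; exists (fun=> f); split=> //; rewrite big_ord1.
Qed.

Lemma ideal_powerM a b f g :
  ideal_power I a f -> ideal_power I b g -> ideal_power I (a + b) (f * g).
Proof.
move=> [m [c [h [Ih ->]]]] [m' [c' [h' [Ih' ->]]]].
rewrite mulr_suml; apply: ideal_gen_sum => i _; rewrite mulr_sumr.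
apply: ideal_gen_sum => j _; rewrite mulrACA; apply: ideal_genM.
have [u [Iu ->]] := Ih i; have [v [Iv ->]] := Ih' j.
apply: mem_ideal_gen.
exists (fun i => match split i with inl j => u j | inr j => v j end).
split; first by move=> k; case: (split k).
rewrite big_split_ord /=; congr (_ * _); apply: eq_bigr => k _.
  by rewrite (unsplitK (inl _ k)).
by rewrite (unsplitK (inr _ k)).
Qed.

Lemma ideal_powerW a b f : (a <= b)%N -> ideal_power I b f -> ideal_power I a f.
Proof.
move=> ab; rewrite -(subnKC ab) => - [m [c [h [Ih ->]]]].
apply: ideal_gen_sum => i _; have [u [Iu ->]] := Ih i.
rewrite big_split_ord /= mulrCA mulrC; apply: ideal_genM; apply: mem_ideal_gen.
by exists (fun j => u (lshift (b - a) j)); split.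
Qed.

End IdealPowers.

Section SymbolicPowers.
Variables (K : fieldType) (n : nat).
Local Notation R := {mpoly K[n.+1]}.
Implicit Types (f g : R) (p : 'rV[K]_n.+1).

Lemma mmap_homog_scale (A : comNzRingType) (phi : {rmorphism K -> A})
    (c : A) (u : 'I_n.+1 -> A) d f : f \is d.-homog ->
  mmap phi (fun i => c * u i) f = c ^+ d * mmap phi u f.
Proof.
move=> /dhomogP fd; rewrite /mmap mulr_sumr big_seq [RHS]big_seq.
apply: eq_bigr => m /fd <- /=; rewrite mulrCA; congr (_ * _).
rewrite mdegE expr_sum -big_split; apply: eq_bigr => i _ /=.
by rewrite exprMn.
Qed.

Lemma proj_point_line (P : proj_point K n) p :
  p != 0 -> p \in val P -> val P = <[p]>%VS.
Proof.
move=> p0 pP; apply/eqP; rewrite eq_sym eqEdim -memvE pP dim_vline p0.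
by rewrite (eqP (valP P)).
Qed.

(** The reversed substitution f(T X + p) = T^D f(X + p/T) moves the coefficient of T^i to T^(D - i).
    As a ring morphism it sends the ideal of P into the multiples of T, hence its k-th power into
    the multiples of T^k. *)
Lemma ideal_power_translate (P : proj_point K n) p k D f :
  p != 0 -> p \in val P -> f \is D.-homog -> ideal_power (point_ideal P) k f ->
  forall i, (D < i + k)%N -> (translate p f)`_i = 0.
Proof.
move=> p0 pP fD fI.
pose phi : {rmorphism K -> {poly R}} := polyC \o @mpolyC n.+1 K.
pose psi : {rmorphism R -> {poly R}} :=
  mmap phi (fun i => 'X * ('X_i)%:P + 1 * phi (p 0 i)).
pose N := size (translate p f).
have le : ldeg_le p N f by rewrite /ldeg_le.
have E : psi f = \sum_(i < N.+1) ((translate p f)`_i)%:P * 'X^(D - i).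
  rewrite /psi /= (mmap_translate phi _ _ le); apply: eq_bigr => i _.
  rewrite expr1n mulr1; have [h1 _] := bihomog_translate p fD i.
  rewrite (mmap_homog_scale phi 'X _ h1) mulrC; congr (_ * _).
  by rewrite -{2}[_`_i]mmap_id (rmorph_mmap (psi := phi) (F := polyC)).
have psiC c : psi c%:MP = c%:MP%:P by rewrite /psi /= mmapC.
have psiX j : psi 'X_j = 'X * ('X_j)%:P + (p 0 j)%:MP%:P.
  by rewrite /psi /= mmapX mmap1U mul1r.
clearbody psi.
pose F k (q : {poly R}) := forall i, (i < k)%N -> q`_i = 0.
have F0 d : F d 0 by move=> i _; rewrite coef0.
have FD d x y : F d x -> F d y -> F d (x + y).
  by move=> hx hy i lt; rewrite coefD hx // hy // addr0.
have FM d e x y : F d x -> F e y -> F (d + e)%N (x * y).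
  move=> hx hy i lt; rewrite coefM big1 // => j _.
  have [/hx ->|dj] := ltnP j d; first by rewrite mul0r.
  by rewrite hy ?mulr0 //; have := ltn_ord j; lia.
have FMr d x y : F d y -> F d (x * y) by move=> hy; have := FM 0%N d x y; apply.
have FI g : point_ideal P g -> F 1%N (psi g).
  move=> [m [c [h [hh ->]]]]; rewrite rmorph_sum.
  apply: (big_ind (F 1%N)) => //; first exact: FD.
  move=> i _; rewrite rmorphM; apply: FMr => - [|//] _.
  have [_ /(_ p p0 pP) hp] := hh i.
  suff <- : (h i).@[p 0]%:MP = (psi (h i))`_0 by rewrite hp mpolyC0.
  rewrite -horner_coef0.
  apply: (mpoly_rmorph_eq (F := @mpolyC n.+1 K \o meval (p 0))
     (G := horner_eval 0 \o psi)) => [r|j] /=.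
    by rewrite mevalC psiC /horner_eval hornerC.
  by rewrite mevalXU psiX /horner_eval hornerD hornerM hornerX mul0r add0r hornerC.
have Fk : F k (psi f).
  move: fI => [m [c [h [hh ->]]]]; rewrite rmorph_sum.
  apply: (big_ind (F k)) => //; first exact: FD.
  move=> i _; rewrite rmorphM; apply: FMr.
  have [u [Iu ->]] := hh i; rewrite rmorph_prod -[k in F k]card_ord -sum1_card.
  by apply: (big_ind2 F) => [//|d x e y|j _]; [exact: FM | exact: FI].
move=> i Di; have [Ni|iN] := leqP N i; first by rewrite nth_default.
have [Di'|iD] := ltnP D i; first by have [_] := bihomog_translate p fD i; apply.
have := Fk (D - i)%N; rewrite E coef_sum (bigD1 (Ordinal (leqW iN))) //= big1.
  rewrite addr0 coefCM coefXn eqxx mulr1; apply; lia.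
move=> j ji; rewrite coefCM coefXn.
have [Dj|jD] := ltnP D j.
  by have [_ ->] := bihomog_translate p fD j; rewrite ?mul0r.
case: eqP => [E'|]; last by rewrite mulr0.
by case/eqP: ji; apply: val_inj => /=; lia.
Qed.

(** Let [lam] be a linear form with value 1 at p; the entries of y = X - lam p vanish on P. In the
    expansion of f = f(y + lam p) the coefficient of lam^i, for i <= e, is a form of degree D - i >=
    k in these entries. *)
Lemma ldeg_ideal_power (P : proj_point K n) p k e D f :
  p != 0 -> p \in val P -> f \is D.-homog -> ldeg_le p e f -> (k + e <= D)%N ->
  ideal_power (point_ideal P) k f.
Proof.
move=> p0 pP fD fe ke.
have /rV0Pn[i0 pi0] := p0.
pose lam : R := (p 0 i0)^-1 *: 'X_i0.
pose y j : R := 'X_j - p 0 j *: lam.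
have Iy j : point_ideal P (y j).
  apply: mem_ideal_gen; split.
    exists 1%N; rewrite /y /lam; apply: rpredB; rewrite ?rpredZ // dhomogX /= mdeg1 //.
  move=> a _; rewrite (proj_point_line p0 pP) => /vlineP[c ->].
  by rewrite /y /lam mevalB !mevalZ !mevalXU !mxE; field.
have -> : f = mmap (@mpolyC n.+1 K) (fun j => y j + lam * (p 0 j)%:MP) f.
  rewrite -[LHS]mmap_id; apply: eq_mmap => j.
  by rewrite /y mulrC mul_mpolyC subrK.
rewrite (mmap_translate (@mpolyC n.+1 K) y lam fe).
apply: ideal_gen_sum => i _; rewrite mulrC; apply: ideal_genM.
have [h1 _] := bihomog_translate p fD i.
have ki : (k <= 1 * (D - i))%N by have := ltn_ord i; lia.
apply: ideal_powerW ki _.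
apply: (mmap_filtration (F := ideal_power (point_ideal P))) h1.
- by move=> d; apply: ideal_gen0.
- by move=> d x z; apply: ideal_genD.
- by move=> c; apply: ideal_power0.
- by move=> d d' x z; apply: ideal_powerM.
by move=> j; apply: ideal_power1.
Qed.

End SymbolicPowers.

(** * Initial degrees of the symbolic powers *)

Section Alpha.
Variables (K : fieldType) (n : nat).
Variables (Z : 'I_(n + 3) -> proj_point K n) (p : 'I_(n + 3) -> 'rV[K]_n.+1).
Hypotheses (p0 : forall i, p i != 0) (pZ : forall i, p i \in val (Z i)).

Lemma lgp_of_points : linearly_general_position Z -> lgp p.
Proof.
move=> hZ v v0; rewrite leqNgt; apply: contra v0 => big.
set S := [set i | _] in big.
pose A := [set i in take n.+1 (enum S)].
have cA : #|A| = n.+1.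
  rewrite cardsE (card_uniqP _) ?take_uniq ?enum_uniq //.
  by rewrite size_takel // -cardE.
have AS i : i \in A -> p i *m v = 0.
  by rewrite inE => /mem_take; rewrite mem_enum inE => /eqP.
have := hZ n A (leqnn _) cA; set U := (\sum_(i in A) _)%VS => dU.
pose ker := lker (linfun (mulmxr v : 'rV[K]_n.+1 -> 'rV[K]_1)).
have Uker : (U <= ker)%VS.
  apply/subv_sumP => i iA; rewrite (proj_point_line (p0 i) (pZ i)) -memvE.
  by rewrite memv_ker lfunE /= AS.
have Ufull : U = fullv.
  by apply/eqP; rewrite -dimv_leqif_eq ?subvf // dU dimvf /dim /= mul1n.
apply/eqP/matrixP => i j; rewrite ord1 mxE.
have : delta_mx 0 i \in ker by apply: (subvP Uker); rewrite Ufull memvf.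
by rewrite memv_ker lfunE /= -rowE => /eqP/matrixP/(_ 0 0); rewrite !mxE.
Qed.

Lemma symbolic_power_form D k e : (k + e = D)%N -> form_through p D (fun=> e) ->
  ideal_degree_nz (symbolic_power Z k) D.
Proof.
move=> ke [f [f0 fD fe]]; exists f; split=> // i.
by apply: ldeg_ideal_power (p0 i) (pZ i) fD (fe i) _; rewrite ke.
Qed.

Lemma form_symbolic_power D k : ideal_degree_nz (symbolic_power Z k) D ->
  (k <= D)%N /\ form_through p D (fun=> D - k)%N.
Proof.
move=> [f [fD fI f0]].
have tr i := ideal_power_translate (p0 i) (pZ i) fD (fI i).
have kD : (k <= D)%N.
  rewrite leqNgt; apply: contra f0 => Dk.
  have l0 : (0 < n + 3)%N by rewrite addnC.
  rewrite -(translate_eq0 (p (Ordinal l0))); apply/eqP/polyP => i.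
  by rewrite coef0 tr // ltn_addl.
split=> //; exists f; split=> // i; apply/leq_sizeP => j jk.
by apply: tr; lia.
Qed.

(** Vanishing to order k in degree D means line degrees at most e = D - k, and N D <= M (D - k)
    amounts to M k <= (M - N) D. *)
Lemma alpha_symbolic_power N M k : (0 < N)%N -> (N < M)%N ->
  (forall D e, form_through p D (fun=> e) <-> (N * D <= M * e)%N) ->
  is_alpha (symbolic_power Z k) (ceil_divn (M * k) (M - N)).
Proof.
move=> N0 NM crit; set b := (M - N)%N; have b0 : (0 < b)%N by rewrite subn_gt0.
have ME : M = (N + b)%N by rewrite subnKC // ltnW.
set a := ceil_divn _ _; split.
  have aP : (M * k <= a * b)%N.
    have := ltn_ceil (M * k + b.-1) b0; rewrite -/(ceil_divn _ _) -/a; nia.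
  have ka : (k <= a)%N by nia.
  by apply: (symbolic_power_form (subnKC ka)); apply/crit; nia.
move=> j /form_symbolic_power[kj /crit h].
by rewrite -ltnS /a /ceil_divn ltn_divLR //; nia.
Qed.

End Alpha.

(** * Apolarity *)

Section Apolarity.
Variables (K : fieldType) (N : nat).
Implicit Types (f g : {mpoly K[N]}) (p : 'rV[K]_N) (m : 'X_{1..N}).

Definition mlin (phi : 'X_{1..N} -> K) g := \sum_(m <- msupp g) g@_m * phi m.

Lemma mlinE phi g k : (msize g <= k)%N ->
  mlin phi g = \sum_(m : 'X_{1..N < k}) g@_m * phi m.
Proof.
move=> le; rewrite /mlin (big_mksub 'X_{1..N < k}) ?msupp_uniq //=.
  by rewrite big_rmcond //= => m /memN_msupp_eq0 ->; rewrite mul0r.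
by move=> m /msize_mdeg_lt /leq_trans; apply.
Qed.

Lemma mlin_is_linear phi : linear_for *%R (mlin phi).
Proof.
move=> c f g; pose k := maxn (msize (c *: f + g)) (maxn (msize f) (msize g)).
rewrite !(@mlinE _ _ k) ?leq_max ?leqnn ?orbT //.
rewrite mulr_sumr -big_split; apply: eq_bigr => m _ /=.
by rewrite mcoeffD mcoeffZ mulrDl mulrA.
Qed.

HB.instance Definition _ phi :=
  GRing.isLinear.Build K {mpoly K[N]} K *%R (mlin phi) (mlin_is_linear phi).

Lemma mlinX phi m : mlin phi 'X_[m] = phi m.
Proof. by rewrite /mlin msuppX big_seq1 mcoeffX eqxx mul1r. Qed.

Definition mfact m : K := (\prod_i (m i)`!)%:R.

(* For this pairing multiplication by the linear form dual to p is adjoint to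
   differentiation along p. *)
Definition apolar f := mlin (fun m => f@_m * mfact m).

HB.instance Definition _ f := GRing.Linear.on (apolar f).

Definition dirderiv p f := \sum_i p 0 i *: f^`M(i).

Definition dual_linear p : {mpoly K[N]} := \sum_i p 0 i *: 'X_i.

Lemma mpoly_lin_ind (P : {mpoly K[N]} -> Prop) :
  (forall m, P 'X_[m]) -> (forall c f g, P f -> P g -> P (c *: f + g)) ->
  forall f, P f.
Proof.
move=> PX PL; have P0 : P 0 by rewrite -[0](addNr 'X_[0]) -scaleN1r; apply: PL.
by elim/mpolyind => // c m f _ _ Pf; apply: (PL).
Qed.

(** The identity (m + e_i)! = (m_i + 1) m! holds over the integers, hence in every
    characteristic. *)
Lemma apolarX f i g : apolar f ('X_i * g) = apolar f^`M(i) g.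
Proof.
elim/mpoly_lin_ind: g => [m|c g h Eg Eh]; last first.
  by rewrite mulrDr -scalerAr !linearP /= Eg Eh.
rewrite -mpolyXD addmC /apolar !mlinX mcoeff_mderiv mulrnAl -mulrnAr.
congr (_ * _); rewrite -[mfact _ *+ _]mulr_natl /mfact -natrM; congr _%:R.
rewrite (bigD1 i) //= [in RHS](bigD1 i) //= mulnA; congr (_ * _)%N.
  by rewrite mnmDE mnm1E eqxx addn1 factS.
by apply: eq_bigr => j ji; rewrite mnmDE mnm1E eq_sym (negPf ji) addn0.
Qed.

Lemma apolar_dual p f g :
  apolar f (dual_linear p * g) = apolar (dirderiv p f) g.
Proof.
rewrite /dual_linear mulr_suml linear_sum /=.
transitivity (\sum_i p 0 i * apolar f^`M(i) g).
  by apply: eq_bigr => i _; rewrite -scalerAl linearZ /= apolarX.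
rewrite /apolar /mlin; under eq_bigr => i _ do rewrite mulr_sumr.
rewrite exchange_big /=; apply: eq_bigr => m _.
rewrite /dirderiv raddf_sum mulr_suml mulr_sumr; apply: eq_bigr => i _ /=.
by rewrite mcoeffZ; ring.
Qed.

Lemma apolar_dualX p f g d :
  apolar f (dual_linear p ^+ d * g) = apolar (iter d (dirderiv p) f) g.
Proof.
elim: d f g => [|d IH] f g; first by rewrite mul1r.
by rewrite exprSr -mulrA IH apolar_dual.
Qed.

Lemma translate_dirderiv p f : (translate p f)^`() = translate p (dirderiv p f).
Proof.
have dD g h : dirderiv p (g + h) = dirderiv p g + dirderiv p h.
  rewrite /dirderiv -big_split; apply: eq_bigr => i _ /=.
  by rewrite mderivD scalerDr.
have dM g h : dirderiv p (g * h) = dirderiv p g * h + g * dirderiv p h.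
  rewrite /dirderiv mulr_suml mulr_sumr -big_split; apply: eq_bigr => i _ /=.
  by rewrite mderivM scalerDr scalerAl scalerAr.
have derivD_eq (a b a' b' : {poly {mpoly K[N]}}) :
    a^`() = a' -> b^`() = b' -> (a + b)^`() = a' + b'.
  by move=> <- <-; exact: derivD.
have derivM_eq (a b a' b' : {poly {mpoly K[N]}}) :
    a^`() = a' -> b^`() = b' -> (a * b)^`() = a' * b + a * b'.
  by move=> <- <-; exact: derivM.
have tD g h : translate p (g + h) = translate p g + translate p h by exact: rmorphD.
have tM g h : translate p (g * h) = translate p g * translate p h by exact: rmorphM.
elim/mpoly_alg_ind: f => [c|i|g h Eg Eh|g h Eg Eh].
- rewrite translateC derivC /dirderiv big1 ?rmorph0 // => i _.
  by rewrite mderivC scaler0.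
- rewrite translateXU derivD derivC derivZ derivX add0r /dirderiv.
  rewrite (bigD1 i) //= big1 => [|j ji].
    rewrite addr0 mderivX mnm1E eqxx.
    have -> : (U_(i) - U_(i) = 0)%MM by apply/mnmP => k; rewrite mnmBE subnn mnm0E.
    by rewrite scale1r mpolyX0 -mul_mpolyC mulr1 translateC -mul_polyC mulr1.
  by rewrite mderivX mnm1E eq_sym (negPf ji) scale0r scaler0.
- by rewrite tD dD tD; apply: derivD_eq.
- by rewrite tM dM tD !tM; apply: derivM_eq.
Qed.

Lemma translate_dirderivn p f d :
  (translate p f)^`(d) = translate p (iter d (dirderiv p) f).
Proof.
elim: d => [|d IH]; first exact: derivn0.
rewrite derivnS; apply: etrans (congr1 (@deriv _) IH) _.
exact: translate_dirderiv.
Qed.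

Lemma dirderiv_eq0 p f e : ldeg_le p e f -> iter e.+1 (dirderiv p) f = 0.
Proof.
move=> fe; apply/eqP; rewrite -(translate_eq0 p) -translate_dirderivn.
by rewrite derivn_poly0.
Qed.

End Apolarity.

Section Characteristic.
Variables (K : fieldType) (b : nat).
Hypothesis charK : pchar_zero_or_gt K b.

Lemma natr_neq0 k : (0 < k)%N -> (k <= b)%N -> k%:R != 0 :> K.
Proof.
move=> k0 kb; apply/negP => k_eq0; have [q qK] := natf0_pchar k0 k_eq0.
have := charK qK; rewrite ltnNge => /negP; apply; apply: leq_trans kb.
by apply: dvdn_leq => //; rewrite (dvdn_pcharf qK).
Qed.

Lemma fact_neq0 k : (k <= b)%N -> k`!%:R != 0 :> K.
Proof.
elim: k => [|k IH] kb; first by rewrite oner_eq0.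
by rewrite factS natrM; apply: mulf_neq0; [exact: natr_neq0 | apply: IH; exact: ltnW].
Qed.

Lemma mfact_neq0 N (m : 'X_{1..N}) : (mdeg m <= b)%N -> mfact K m != 0.
Proof.
move=> mb; rewrite /mfact natr_prod; apply/prodf_neq0 => i _; apply: fact_neq0.
by apply: leq_trans mb; rewrite mdegE (bigD1 i) //= leq_addr.
Qed.

(** Deriving e + 1 times multiplies the coefficient of T^k by a falling factorial that divides k!,
    and k! is nonzero in K for k <= j <= b. *)
Lemma ldeg_dirderiv N (p : 'rV[K]_N) (f : {mpoly K[N]}) j e :
  (j <= b)%N -> f \is j.-homog -> iter e.+1 (dirderiv p) f = 0 -> ldeg_le p e f.
Proof.
move=> jb fj d0; apply/leq_sizeP => k ek.
have [jk|kj] := ltnP j k; first by have [_] := bihomog_translate p fj k; apply.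
have := translate_dirderivn p f e.+1; rewrite d0 rmorph0 => /polyP/(_ (k - e.+1)%N).
rewrite coef_derivn coef0 subnKC // -scaler_nat => /eqP; rewrite scaler_eq0.
case/orP => [|/eqP //]; have := fact_neq0 (leq_trans kj jb).
by rewrite -(ffact_fact ek) natrM mulf_eq0 negb_or => /andP[/negPf ->].
Qed.

End Characteristic.

(** * Regularity modulo powers of linear forms *)

Section Regularity.
Variables (K : fieldType) (n e b : nat).
Variables (p : 'I_(n + 3) -> 'rV[K]_n.+1) (l : 'I_(n + 3) -> {mpoly K[n.+1]}).
Hypothesis lE : forall i, l i = dual_linear (p i).
Hypothesis charK : pchar_zero_or_gt K b.
Local Notation I := (powers_ideal l e.+1).

(** Pairing with f kills the ideal, because multiplication by l_i^(e+1) is adjoint to e + 1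
    derivations along p_i. On a monomial m of f the pairing is the coefficient times m!, which is
    nonzero. *)
Lemma quotient_of_form j : (j <= b)%N -> form_through p j (fun=> e) ->
  quotient_degree_nz I j.
Proof.
move=> jb [f [f0 fj fe]].
have [m mf] : exists m, m \in msupp f.
  by move: f0; rewrite -msupp_eq0; case: (msupp f) => // m s _; exists m; rewrite mem_head.
have mj : mdeg m = j by apply: (dhomogP _ _ _ fj).
exists 'X_[m]; split; first by rewrite dhomogX /= mj.
move=> [k [c [g [hg E]]]].
have : apolar f 'X_[m] = 0.
  rewrite E linear_sum big1 // => i _ /=.
  by have [s ->] := hg i; rewrite mulrC lE apolar_dualX dirderiv_eq0 // /apolar /mlin;
    rewrite big1 // => ? _; rewrite mcoeff0 mul0r mulr0.
rewrite /apolar mlinX => /eqP; rewrite mulf_eq0 -[_ == 0]negbK -mcoeff_msupp mf /=.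
by apply/negP; apply: (mfact_neq0 charK); rewrite mj.
Qed.

Lemma dirderiv_homog (q : 'rV[K]_n.+1) (f : {mpoly K[n.+1]}) j d m :
  f \is j.-homog -> (mdeg m + d != j)%N -> (iter d (dirderiv q) f)@_m = 0.
Proof.
move=> fj; elim: d m => [|d IH] m md; first by rewrite addn0 in md; apply: dhomog_nemf_coeff fj md.
rewrite iterS /dirderiv raddf_sum big1 // => i _ /=.
by rewrite mcoeffZ mcoeff_mderiv IH ?mul0rn ?mulr0 // mdegD mdeg1 addn1 addSnnS.
Qed.

(** Linear algebra in degree j: either g is in the span of the multiples of the generators, or a
    functional separates it from them, and apolarity turns this functional into a form. *)
Lemma form_of_quotient j g : (j <= b)%N -> g \is j.-homog ->
  I g \/ form_through p j (fun=> e).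
Proof.
move=> jb gj.
pose T : finType := 'X_{1..n.+1 < j.+1}; pose S : finType := ('I_(n + 3) * T)%type.
(* Multiples of the wrong degree are replaced by 0, so that all rows are forms of degree j. *)
pose gen (s : S) : {mpoly K[n.+1]} :=
  if (mdeg s.2 + e.+1 == j)%N then l s.1 ^+ e.+1 * 'X_[s.2] else 0.
have lj i : l i \is 1.-homog.
  rewrite lE; apply: rpred_sum => k _; apply: dhomogZ; by rewrite dhomogX /= mdeg1.
have lXj i m : (mdeg m + e.+1 = j)%N -> l i ^+ e.+1 * 'X_[m] \is j.-homog.
  move=> <-; rewrite addnC; apply: dhomogM; last by rewrite dhomogX.
  by have := dhomogMn e.+1 (lj i); rewrite mul1n.
have genj s : gen s \is j.-homog.
  by rewrite /gen; case: eqP => [/lXj|_]; [apply | exact: dhomog0].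
pose coord (f : {mpoly K[n.+1]}) : 'rV[K]_#|T| := \row_t f@_(val (enum_val t)).
pose G : 'M[K]_(#|S|, #|T|) := \matrix_s coord (gen (enum_val s)).
have [/submxP[D gD]|] := boolP (coord g <= G)%MS.
  left; have -> : g = \sum_s D 0 s *: gen (enum_val s).
    apply/mpolyP => m; have [mj|mj] := eqVneq (mdeg m) j; last first.
      rewrite (dhomog_nemf_coeff gj mj) raddf_sum big1 // => s _ /=.
      by rewrite mcoeffZ (dhomog_nemf_coeff (genj _) mj) mulr0.
    have mT : (mdeg m < j.+1)%N by rewrite mj.
    have /matrixP/(_ 0 (enum_rank (BMultinom mT : T))) := gD.
    rewrite !mxE enum_rankK /= => ->; rewrite raddf_sum; apply: eq_bigr => s _ /=.
    by rewrite mcoeffZ !mxE enum_rankK.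
  apply: ideal_gen_sum => s _; rewrite -mul_mpolyC; apply: ideal_genM.
  rewrite /gen; case: eqP => _; last exact: ideal_gen0.
  by rewrite mulrC; apply: ideal_genM; apply: mem_ideal_gen; exists (enum_val s).1.
rewrite submxE => /rV0Pn[t0 ht0]; right.
(* A column of the cokernel: a functional that is zero on every row of [G] but not on g. *)
pose u t := cokermx G t t0.
have Gu s : \sum_t (gen s)@_(val (enum_val t)) * u t = 0.
  have := mulmx_coker G => /matrixP/(_ (enum_rank s) t0); rewrite mxE [RHS]mxE => E.
  by rewrite -[RHS]E; apply: eq_bigr => t _; rewrite [G _ _]mxE mxE enum_rankK.
have gu : \sum_t g@_(val (enum_val t)) * u t != 0.
  move: ht0; rewrite mxE; apply: contra_neq => E.
  by rewrite -[RHS]E; apply: eq_bigr => t _; rewrite [coord g _ _]mxE.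
pose lam (m : 'X_{1..n.+1}) : K :=
  if insub m is Some t then u (enum_rank (t : T)) else 0.
have lamE h : h \is j.-homog -> \sum_t h@_(val (enum_val t)) * u t = mlin lam h.
  move=> hj; have hs : (msize h <= j.+1)%N.
    rewrite mmeasureE big_seq; apply: (big_ind (fun x => (x <= j.+1)%N)) => //.
      by move=> x y hx hy; rewrite geq_max hx.
    by move=> m /(dhomogP _ _ _ hj) /= ->.
  rewrite (mlinE _ hs) (reindex_onto (@enum_val T _) enum_rank) /=; last first.
    by move=> t _; rewrite enum_rankK.
  apply: eq_big => [t|t _]; first by rewrite enum_valK eqxx.
  by rewrite /lam valK enum_valK.
(* Dividing by m! represents the functional as the pairing with [F]; here the bound j <= b
   enters. *)
pose F : {mpoly K[n.+1]} :=
  \sum_(t : T | mdeg t == j) (lam t / mfact K t) *: 'X_[t].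
have Fj : F \is j.-homog.
  by apply: rpred_sum => t tj; apply: dhomogZ; rewrite dhomogX.
have FE m : mdeg m = j -> F@_m * mfact K m = lam m.
  move=> mj; have mT : (mdeg m < j.+1)%N by rewrite mj.
  rewrite /F raddf_sum (bigD1 (BMultinom mT : T)) /= ?mj //= big1 => [|t /andP[_ tm]].
    rewrite mcoeffZ mcoeffX eqxx mulr1 addr0 divfK //.
    by apply: (mfact_neq0 charK); rewrite mj.
  rewrite mcoeffZ mcoeffX; case: eqP => [E|_]; last by rewrite mulr0.
  by case/eqP: tm; apply: val_inj.
have apF h : h \is j.-homog -> apolar F h = mlin lam h.
  move=> /dhomogP hj; rewrite /apolar /mlin big_seq [RHS]big_seq.
  by apply: eq_bigr => m /hj /= mj; rewrite FE.
exists F; split=> //.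
  apply: contra_neq gu => F0; rewrite lamE // -apF // F0 /apolar /mlin.
  by rewrite big1 // => m _; rewrite mcoeff0 mul0r mulr0.
(* Orthogonality of [F] to l_i^(e+1) X^m makes the coefficient at m of its (e + 1)-st derivative
   along p_i vanish. *)
move=> i; apply: (ldeg_dirderiv charK jb Fj); apply/mpolyP => m; rewrite mcoeff0.
have [mj|mj] := eqVneq (mdeg m + e.+1)%N j; last exact: dirderiv_homog Fj mj.
have mT : (mdeg m < j.+1)%N by lia.
have := Gu (i, BMultinom mT : T); rewrite lamE // -apF //.
rewrite /gen /= mj eqxx lE apolar_dualX /apolar mlinX => /eqP; rewrite mulf_eq0.
by case/orP => [/eqP //|]; rewrite (negPf (mfact_neq0 charK _)) //; lia.
Qed.

(** The bound [b] is one above the regularity because apolarity is applied up to degree rho + 1,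
    where the quotient vanishes; higher monomials are multiples of those of degree rho + 1. *)
Lemma reg_powers_ideal N M : (0 < N)%N -> b = (M * e %/ N + 1)%N ->
  (forall D d, form_through p D (fun=> d) <-> (N * D <= M * d)%N) ->
  is_reg_quotient I (M * e %/ N).
Proof.
move=> N0 bE crit; set rho := (M * e %/ N)%N; split.
  by apply: quotient_of_form; [rewrite bE leq_addr | apply/crit; rewrite mulnC leq_divM].
have rho_b : (rho.+1 <= b)%N by rewrite bE addn1.
have Irho g : g \is (rho.+1).-homog -> I g.
  move=> /(form_of_quotient rho_b)[//|/crit]; rewrite mulnC -leq_divRL //.
  by rewrite ltnn.
have Imon k m : mdeg m = (rho.+1 + k)%N -> I 'X_[m].
  elim: k m => [|k IH] m mk; first by apply: Irho; rewrite dhomogX /= mk addn0.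
  have [i mi] : exists i, m i != 0%N.
    apply/existsP; rewrite -negb_forall; apply/negP => /forallP m0.
    by move: mk; rewrite mdegE big1 // => i _; apply/eqP.
  have mE : m = (U_(i) + (m - U_(i)))%MM by rewrite addmC submK // lep1mP.
  rewrite mE mpolyXD; apply: ideal_genM; apply: IH.
  by have := mdegD U_(i) (m - U_(i)); rewrite -mE mdeg1 mk addnS; lia.
move=> j [f [fj fI]]; rewrite leqNgt; apply/negP => rj; apply: fI.
rewrite [f]mpolyE big_seq; apply: ideal_gen_sum => m /(dhomogP _ _ _ fj) /= mj.
rewrite -mul_mpolyC; apply: ideal_genM; apply: (Imon (j - rho.+1)%N).
by rewrite mj subnKC.
Qed.

End Regularity.

(* From the two numerical criteria to regularity and initial degree *)
Local Close Scope ring_scope.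

Theorem theorem4p4 (K : fieldType) (n : nat)
    (Z : 'I_(n + 3) -> proj_point K n)
    (l : 'I_(n + 3) -> {mpoly K[n.+1]}) (d k : nat) :
  2 <= n ->
  injective Z ->
  linearly_general_position Z ->
  (forall i, dual_form (Z i) (l i)) ->
  0 < d -> 0 < k ->
  (* (i) *)
  ((~~ odd n ->
    pchar_zero_or_gt K (((n + 2) * (d - 1)) %/ 2 + 1) ->
    is_reg_quotient (powers_ideal l d) (((n + 2) * (d - 1)) %/ 2))
   /\
   (odd n ->
    (n + 2 %| d - 1) \/ n ^ 2 + n + 2 <= d ->
    pchar_zero_or_gt K
      (((n + 1) * (n + 3) * (d - 1)) %/ (2 * (n + 2)) + 1) ->
    is_reg_quotient (powers_ideal l d)
      (((n + 1) * (n + 3) * (d - 1)) %/ (2 * (n + 2)))))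
  /\
  (* (ii) *)
  ((~~ odd n ->
    is_alpha (symbolic_power Z k) (ceil_divn ((n + 2) * k) n))
   /\
   (odd n ->
    ((n ^ 2 + 2 * n - 1) %/ 2 %| k) \/
      (n ^ 2 + n + 1) * (n ^ 2 + 2 * n - 1) <= k * (2 * (n + 2)) ->
    is_alpha (symbolic_power Z k)
      (ceil_divn ((n + 1) * (n + 3) * k) (n ^ 2 + 2 * n - 1))))
  /\
  (* (iii) *)
  (odd n ->
    (exists a, is_alpha (symbolic_power Z k) a /\
       ceil_divn ((n + 1) * (n + 3) * k) (n ^ 2 + 2 * n - 1) <= a)
    /\
    (pchar_zero_or_gt K
       (((n + 1) * (n + 3) * (d - 1)) %/ (2 * (n + 2)) + 1) ->
     exists r, is_reg_quotient (powers_ideal l d) r /\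
       r <= ((n + 1) * (n + 3) * (d - 1)) %/ (2 * (n + 2)))).
Proof.
move=> n2 _ hZ hl d0 k0.
have n0 : 0 < n by apply: ltnW.
have [p hp] : exists p : 'I_(n + 3) -> 'rV[K]_n.+1, forall i,
    [/\ p i != 0%R, p i \in val (Z i) & l i = dual_linear (p i)].
  exact: fin_all_exists hl.
have p0 i : (p i != 0)%R by case: (hp i).
have pZ i : p i \in val (Z i) by case: (hp i).
have lE i : l i = dual_linear (p i) by case: (hp i).
have lgpp := lgp_of_points p0 pZ hZ.
have alpha := alpha_symbolic_power p0 pZ.
(* The exponent d is written as e + 1 with e = d - 1. *)
have reg := @reg_powers_ideal K n (d - 1) _ p l lE.
rewrite subn1 prednK // -subn1 in reg.
have even_crit : ~~ odd n -> forall D e,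
    form_through p D (fun=> e) <-> 2 * D <= (n + 2) * e.
  move=> en D e; split; first exact: form_through_even.
  exact: exists_form_even.
have odd_crit : odd n -> forall D e,
    form_through p D (fun=> e) <-> 2 * (n + 2) * D <= (n + 1) * (n + 3) * e.
  move=> on D e; split; first exact: form_through_odd.
  have nE : n.+1 = 2 * n.+1./2 by rewrite mul2n -[LHS]odd_double_half /= on.
  by apply: (exists_form_odd lgpp _ nE); lia.
have odd_alpha : odd n -> is_alpha (symbolic_power Z k)
    (ceil_divn ((n + 1) * (n + 3) * k) (n ^ 2 + 2 * n - 1)).
  move=> /odd_crit crit; have := alpha _ _ k _ _ crit.
  (* The denominator is M - N for the coefficients M = (n + 1)(n + 3) and N = 2 (n + 2) of the odd
     criterion. *)
  have -> : (n + 1) * (n + 3) - 2 * (n + 2) = n ^ 2 + 2 * n - 1 by rewrite -mulnn; nia.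
  by apply; nia.
have odd_reg : odd n -> pchar_zero_or_gt K
      (((n + 1) * (n + 3) * (d - 1)) %/ (2 * (n + 2)) + 1) ->
    is_reg_quotient (powers_ideal l d)
      (((n + 1) * (n + 3) * (d - 1)) %/ (2 * (n + 2))).
  by move=> /odd_crit crit charK; apply: (reg _ charK) => //; lia.
split; [split|split; [split|]].
- by move=> /even_crit crit charK; apply: (reg _ charK).
- by move=> on _; apply: odd_reg.
- move=> /even_crit crit; have := alpha _ _ k _ _ crit.
  by rewrite addnK; apply; lia.
- by move=> on _; apply: odd_alpha.
move=> on; split; last by move=> charK; exists (((n + 1) * (n + 3) * (d - 1)) %/ (2 * (n + 2))); split=> //; apply: odd_reg.
by exists (ceil_divn ((n + 1) * (n + 3) * k) (n ^ 2 + 2 * n - 1)); split=> //; apply: odd_alpha.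
Qed.
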